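(* Let $\mathcal C$ be a monotone class of coloured digraphs of a fixed finite signature. The following are equivalent: (1) $\underline{\mathcal C}$ is nowhere dense; (2) $\underline{\mathcal C}$ is superflat; (3) $\mathcal C$ is stable; (4) $\underline{\mathcal C}$ is stable; (5) $\mathcal C$ is dependent; (6) $\underline{\mathcal C}$ is dependent.
   Context: A coloured digraph is a relational structure all of whose relation symbols have arity at most $2$ (nullary relation symbols allowed). A class $\mathcal C$ of relational structures is monotone if whenever $M\to N$ is an injective homomorphism and $N\in\mathcal C$, then $M\in\mathcal C$ (in particular $\mathcal C$ is closed under isomorphism and non-induced substructures). The underlying (Gaifman) graph $\underline M$ has vertex set the universe of $M$, with $a,b$ adjacent iff $a\ne b$ and both occur in some tuple of some relation of $M$; $\underline{\mathcal C}=\{\underline M:M\in\mathcal C\}$. Graphs are undirected, loopless, without multiple edges, possibly infinite. A graph $H$ is an $r$-minor of $G$ if there is a subgraph $U\subseteq G$ and an equivalence relation on the vertices of $U$ with connected classes, each containing a vertex at distance at most $r$ from all others in the class, such that $H$ is isomorphic to the result of contracting each class to a vertex; a class of graphs is nowhere dense if for every $r$ there is a finite bound on the size of cliques occurring as $r$-minors of its members. $K_m^r$ is $K_m$ with each edge subdivided exactly $r$ times; a class of graphs is superflat if for every $r$ there is $m$ such that $K_m^r$ is not a subgraph of any member. A first-order formula $\phi(\bar x,\bar y)$ has the order property w.r.t. a class $\mathcal K$ if for every $n$ there are $M\in\mathcal K$ and tuples $\bar a_0,\dots,\bar a_{n-1},\bar b_0,\dots,\bar b_{n-1}$ in $M$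 with $M\models\phi(\bar a_i,\bar b_j)$ iff $i<j$; $\mathcal K$ is stable if no formula has the order property w.r.t. $\mathcal K$. $\phi(\bar x,\bar y)$ has the independence property w.r.t. $\mathcal K$ if for every $n$ there are $M\in\mathcal K$, tuples $\bar a_0,\dots,\bar a_{n-1}$ and $\bar b_J$ ($J\subseteq\{0,\dots,n-1\}$) in $M$ with $M\models\phi(\bar a_i,\bar b_J)$ iff $i\in J$; $\mathcal K$ is dependent if no formula has the independence property w.r.t. $\mathcal K$. *)

(* Defs.v *)
From Stdlib Require Import List Arith PeanoNat.
Import ListNotations.

Set Implicit Arguments.

(** A finite relational signature all of whose symbols have arity <= 2
    (nullary symbols allowed): "coloured digraphs". *)
Record signature := {
  sym : Type;
  arity : sym -> nat;
  arity_le2 : forall s, arity s <= 2;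
  sym_finite : exists l : list sym, forall s, In s l
}.

Record structure (S : signature) := {
  carrier : Type;
  rel : forall s : sym S, list carrier -> Prop;
  rel_arity : forall s l, rel s l -> length l = arity S s
}.
Arguments carrier {S} _.
Arguments rel {S} _ _ _.

Definition inj_hom {S} (M N : structure S) (f : carrier M -> carrier N) : Prop :=
  (forall x y, f x = f y -> x = y) /\
  (forall s l, rel M s l -> rel N s (map f l)).

Definition monotone {S} (C : structure S -> Prop) : Prop :=
  forall (M N : structure S) (f : carrier M -> carrier N),
    inj_hom M N f -> C N -> C M.

Definition graph_sig : signature.
Proof.
  refine {| sym := unit; arity := fun _ => 2 |}.
  - intros _; exact (le_n 2).
  - exists [tt]; intros []; left; reflexivity.
Defined.

Definition graph := structure graph_sig.

Definition adj (G : graph) (a b : carrier G) : Prop := rel G (tt : sym graph_sig) [a; b].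

(** The graph on V with edge relation E (E is intended symmetric, irreflexive). *)
Definition mk_graph (V : Type) (E : V -> V -> Prop) : graph.
Proof.
  refine {| carrier := V;
            rel := fun _ l => exists a b, l = [a; b] /\ E a b |}.
  intros s l [a [b [Hl _]]]; rewrite Hl; reflexivity.
Defined.

Definition gaifman {S} (M : structure S) : graph :=
  mk_graph (fun a b : carrier M =>
              a <> b /\ exists (s : sym S) (l : list (carrier M)),
                           rel M s l /\ In a l /\ In b l).

Definition underline {S} (C : structure S -> Prop) : graph -> Prop :=
  fun G => exists M, C M /\ G = gaifman M.

Definition complete (m : nat) : graph :=
  mk_graph (fun i j : {i : nat | i < m} => i <> j).

(** K_m^r : K_m with every edge subdivided exactly r times.  Branch vertices
    are inl i (i < m); the subdivision vertices of the edge {i,j} (i < j) are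
    inr ((i,j),k), k < r, forming the path
    i - ((i,j),0) - ((i,j),1) - ... - ((i,j),r-1) - j. *)
Definition subdiv_vertex (r m : nat) : Type :=
  ({i : nat | i < m} +
   {p : nat * nat * nat | fst (fst p) < snd (fst p) < m /\ snd p < r})%type.

Definition subdiv_base (r m : nat) (x y : subdiv_vertex r m) : Prop :=
  match x, y with
  | inl i, inl j => r = 0 /\ proj1_sig i < proj1_sig j
  | inl i, inr p => fst (fst (proj1_sig p)) = proj1_sig i /\ snd (proj1_sig p) = 0
  | inr p, inr q => fst (proj1_sig p) = fst (proj1_sig q)
                    /\ S (snd (proj1_sig p)) = snd (proj1_sig q)
  | inr p, inl j => snd (fst (proj1_sig p)) = proj1_sig j
                    /\ S (snd (proj1_sig p)) = r
  end.

Definition subdivided_clique (r m : nat) : graph :=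
  mk_graph (fun x y : subdiv_vertex r m => subdiv_base x y \/ subdiv_base y x).

Inductive reach {V : Type} (P : V -> Prop) (E : V -> V -> Prop) : nat -> V -> V -> Prop :=
| reach0 : forall n x, P x -> reach P E n x x
| reachS : forall n x y z, P x -> E x y -> reach P E n y z -> reach P E (S n) x z.

(** H is an r-minor of G: there are a subgraph U of G (vertex set uv, edge
    set ue) and a map pi from the vertices of U onto the vertices of H whose
    fibres are the equivalence classes; each class contains a vertex c at
    distance at most r (inside the class, in U) from all vertices of the
    class (so classes are connected), and H is the result of contracting the
    classes (pi induces the isomorphism). *)
Definition rminor (r : nat) (H G : graph) : Prop :=
  exists (uv : carrier G -> Prop) (ue : carrier G -> carrier G -> Prop)
         (pi : carrier G -> carrier H),
    (forall x y, ue x y -> adj G x y /\ uv x /\ uv y /\ ue y x) /\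
    (forall a : carrier H, exists c, uv c /\ pi c = a /\
        forall y, uv y -> pi y = a ->
          reach (fun z => uv z /\ pi z = a) ue r c y) /\
    (forall a b : carrier H,
        adj H a b <-> a <> b /\ exists x y, ue x y /\ pi x = a /\ pi y = b).

Definition nowhere_dense (K : graph -> Prop) : Prop :=
  forall r : nat, exists N : nat,
    forall (G : graph) (m : nat), K G -> rminor r (complete m) G -> m <= N.

Definition superflat (K : graph -> Prop) : Prop :=
  forall r : nat, exists m : nat,
    forall G : graph, K G ->
      ~ exists f : carrier (subdivided_clique r m) -> carrier G,
          inj_hom (subdivided_clique r m) G f.

Inductive formula (S : signature) : Type :=
| FRel : sym S -> list nat -> formula S
| FEq : nat -> nat -> formula S
| FNot : formula S -> formula S
| FAnd : formula S -> formula S -> formula S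
| FEx : nat -> formula S -> formula S.
Arguments FRel {S}. Arguments FEq {S}. Arguments FNot {S}. Arguments FAnd {S}. Arguments FEx {S}.

Fixpoint sat {S} (M : structure S) (rho : nat -> carrier M) (phi : formula S) : Prop :=
  match phi with
  | FRel s vs => rel M s (map rho vs)
  | FEq x y => rho x = rho y
  | FNot p => ~ sat M rho p
  | FAnd p q => sat M rho p /\ sat M rho q
  | FEx x p => exists a, sat M (fun v => if Nat.eqb v x then a else rho v) p
  end.

(** A formula phi(x,y): the variables < k form the tuple x, the (finitely
    many free) variables >= k form the tuple y.  join k a b assigns the
    x-variables according to a and the y-variables according to b. *)
Definition join {A : Type} (k : nat) (a b : nat -> A) : nat -> A :=
  fun v => if v <? k then a v else b v.

Definition order_property {S} (K : structure S -> Prop) (phi : formula S) (k : nat) : Prop :=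
  forall n : nat, exists M : structure S, K M /\
    exists a b : nat -> nat -> carrier M,
      forall i j, i < n -> j < n -> (sat M (join k (a i) (b j)) phi <-> i < j).

Definition stable {S} (K : structure S -> Prop) : Prop :=
  forall (phi : formula S) (k : nat), ~ order_property K phi k.

Definition independence_property {S} (K : structure S -> Prop) (phi : formula S) (k : nat) : Prop :=
  forall n : nat, exists M : structure S, K M /\
    exists a : nat -> nat -> carrier M,
      forall J : nat -> Prop, exists bJ : nat -> carrier M,
        forall i, i < n -> (sat M (join k (a i) bJ) phi <-> J i).

Definition dependent {S} (K : structure S -> Prop) : Prop :=
  forall (phi : formula S) (k : nat), ~ independence_property K phi k.

(* Main.v *)
From Stdlib Require Import List Arith Lia Classical ClassicalEpsilon.
Require Import Defs.
Import ListNotations.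

(** The implications proved are (1) => (3) => (4), (5) => (6) => (2) => (1).

    (1) => (3).  In a nowhere dense class, deleting a set [F] of bounded size
    leaves any prescribed number of members of a long enough sequence of tuples
    pairwise far apart.  Two of them, [c i] and [c j], have the same type of
    quantifier rank [q] in the expansion by the distances to the tuple itself,
    and Duplicator wins the [q]-round game that exchanges them: pebbles close to
    the tuples are answered in the other neighbourhood, all others by themselves,
    and a gap in the distances separates the two kinds of pebbles.  So no formula
    of rank [q] orders the tuples.

    (6) => (2).  If all [K_m^r] occur as subgraphs, monotonicity yields the
    [r]-subdivisions of all bipartite graphs, where "there is a walk of length
    [r + 1] from [x] to [y]" has the independence property.

    (2) => (1).  A branch set that is joined to many others contains, by the
    sunflower lemma applied to paths from its centre, a hub with many disjoint
    paths leading to other branch sets.  Choosing hubs successively for nested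
    families and connecting them through further branch sets gives a subdivided
    clique, whose subdivision Ramsey's theorem makes uniform. *)

(** * Sublists, Ramsey's theorem and sunflowers *)

(** All bounds have to be uniform over the class, and the order in which they are chosen shapes the
    statements. In (1) => (3) the deleted vertices act as constants, so the number of types grows
    with their number; hence the size of the deleted set must be fixed before the number of
    surviving tuples is prescribed, and the lemmas on scattering have the form: some [s], for every
    [m], some [n]. The game is played directly, without a local normal form of formulas. It works
    because the gap may be halved in each round, so that rank [q] costs a radius of only [2 ^ q]. In
    (2) => (1) the paths between hubs have bounded but different lengths, whereas superflatness
    excludes each length with a bound of its own; therefore the pairs of hubs are coloured by
    length. In (6) => (2) the subdivided clique lives in a Gaifman graph while monotonicity is about
    structures, so edges have to be deleted through tuples. *)

Definition decb (P : Prop) : bool :=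
  if excluded_middle_informative P then true else false.

Lemma decb_true (P : Prop) : decb P = true <-> P.
Proof. unfold decb; destruct (excluded_middle_informative P); intuition discriminate. Qed.

Lemma decb_false (P : Prop) : negb (decb P) = true <-> ~ P.
Proof. unfold decb; destruct (excluded_middle_informative P); simpl; intuition discriminate. Qed.

(** Keeping the order lets [ForallOrdPairs] pass to sublists even for relations that are not
    symmetric. *)
Inductive sublist {A : Type} : list A -> list A -> Prop :=
| sublist_nil : forall l, sublist [] l
| sublist_skip : forall x l l', sublist l l' -> sublist l (x :: l')
| sublist_cons : forall x l l', sublist l l' -> sublist (x :: l) (x :: l').

Lemma sublist_refl {A} (l : list A) : sublist l l.
Proof. induction l; [apply sublist_nil|apply sublist_cons; auto]. Qed.

Lemma sublist_incl {A} (l l' : list A) : sublist l l' -> incl l l'.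
Proof. induction 1; intros y Hy; simpl in *; intuition. Qed.

Lemma sublist_trans {A} (l1 l2 l3 : list A) :
  sublist l1 l2 -> sublist l2 l3 -> sublist l1 l3.
Proof.
  intros H12 H23; revert l1 H12.
  induction H23 as [l3|x l2 l3 H IH|x l2 l3 H IH]; intros l1 H12.
  - inversion H12; constructor.
  - apply sublist_skip; auto.
  - inversion H12; subst; [apply sublist_nil|apply sublist_skip; auto|apply sublist_cons; auto].
Qed.

Lemma sublist_NoDup {A} (l l' : list A) : sublist l l' -> NoDup l' -> NoDup l.
Proof.
  induction 1 as [l|x l l' H IH|x l l' H IH]; intros Hn.
  - constructor.
  - inversion Hn; auto.
  - inversion Hn; subst; constructor; auto.
    intros Hx; apply H2, (sublist_incl _ _ H); auto.
Qed.

Lemma sublist_ForallOrdPairs {A} (R : A -> A -> Prop) (l l' : list A) :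
  sublist l l' -> ForallOrdPairs R l' -> ForallOrdPairs R l.
Proof.
  induction 1 as [l|x l l' H IH|x l l' H IH]; intros Hn.
  - constructor.
  - inversion Hn; auto.
  - inversion Hn; subst; constructor; auto.
    rewrite Forall_forall in *; intros y Hy; apply H2, (sublist_incl _ _ H); auto.
Qed.

Lemma sublist_filter {A} (f : A -> bool) (l : list A) : sublist (filter f l) l.
Proof. induction l as [|x l IH]; simpl; [constructor|destruct (f x); [apply sublist_cons|apply sublist_skip]; auto]. Qed.

Lemma sublist_firstn {A} n (l : list A) : sublist (firstn n l) l.
Proof.
  revert n; induction l as [|x l IH]; intros [|n]; simpl; try apply sublist_nil.
  apply sublist_cons; auto.
Qed.

Lemma ForallOrdPairs_impl {A} (R R' : A -> A -> Prop) (l : list A) :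
  (forall x y, In x l -> In y l -> R x y -> R' x y) ->
  ForallOrdPairs R l -> ForallOrdPairs R' l.
Proof.
  intros H HF; induction HF as [|x l Hx HF IH]; constructor.
  - rewrite Forall_forall in *; intros y Hy; apply H; simpl; auto.
  - apply IH; intros; apply H; simpl; auto.
Qed.

Lemma ForallOrdPairs_sym {A} {R : A -> A -> Prop} {l : list A} :
  ForallOrdPairs R l -> (forall x y, R x y -> R y x) ->
  forall x y, In x l -> In y l -> x <> y -> R x y.
Proof.
  intros HF Hs x y Hx Hy Hxy.
  destruct (ForallOrdPairs_In HF x y Hx Hy) as [?|[?|?]]; [contradiction|auto|auto].
Qed.

Lemma ForallOrdPairs_all {A} (R : A -> A -> Prop) (l : list A) :
  (forall x y, In x l -> In y l -> R x y) -> ForallOrdPairs R l.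
Proof.
  induction l as [|x l IH]; intros H; constructor.
  - apply Forall_forall; intros y Hy; apply H; simpl; auto.
  - apply IH; intros; apply H; simpl; auto.
Qed.

Lemma ForallOrdPairs_and {A} (R R' : A -> A -> Prop) (l : list A) :
  ForallOrdPairs R l -> ForallOrdPairs R' l -> ForallOrdPairs (fun x y => R x y /\ R' x y) l.
Proof.
  induction 1 as [|x l Hx H IH]; intros H'; inversion H'; subst; constructor; auto.
  rewrite Forall_forall in *; auto.
Qed.

Lemma ForallOrdPairs_nth {A} (R : A -> A -> Prop) d l : ForallOrdPairs R l ->
  forall i j, i < j < length l -> R (nth i l d) (nth j l d).
Proof.
  induction 1 as [|x l Hx H IH]; intros i j [Hi Hj]; simpl in Hj; [lia|].
  destruct j as [|j]; [lia|]; destruct i as [|i]; simpl.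
  - rewrite Forall_forall in Hx; apply Hx, nth_In; lia.
  - apply IH; lia.
Qed.

(** The recurrence of Erdős and Szekeres: the head splits the tail by its relation to it, and one of
    the two parts is long enough. Only pairs in the order of the list count, so [R] may be any
    relation. *)
Lemma ramsey (m1 m2 : nat) : exists n, forall (A : Type) (R : A -> A -> Prop) (l : list A),
  n <= length l -> exists l', sublist l' l /\
    ((length l' = m1 /\ ForallOrdPairs R l') \/
     (length l' = m2 /\ ForallOrdPairs (fun x y => ~ R x y) l')).
Proof.
  revert m2; induction m1 as [|m1 IH1]; intros m2.
  { exists 0; intros; exists []; split; [constructor|left; repeat constructor]. }
  induction m2 as [|m2 [n2 IH2]].
  { exists 0; intros; exists []; split; [constructor|right; repeat constructor]. }
  destruct (IH1 (S m2)) as [n1 IH].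
  exists (S (n1 + n2)); intros A R [|x l] Hl; simpl in Hl; [lia|].
  pose (f := fun y => decb (R x y)).
  pose proof (filter_length f l) as Hf.
  assert (Hc : n1 <= length (filter f l) \/ n2 <= length (filter (fun y => negb (f y)) l)) by lia.
  destruct Hc as [Hc|Hc].
  - destruct (IH A R _ Hc) as (l' & Hs & [[Hm HF]|[Hm HF]]).
    + exists (x :: l'); split.
      { apply sublist_cons; eapply sublist_trans; [eassumption|apply sublist_filter]. }
      left; simpl; split; [lia|]; constructor; auto.
      apply Forall_forall; intros y Hy; apply (sublist_incl _ _ Hs), filter_In in Hy.
      apply decb_true, Hy.
    + exists l'; split; [|auto].
      apply sublist_skip; eapply sublist_trans; [eassumption|apply sublist_filter].
  - destruct (IH2 A R _ Hc) as (l' & Hs & [[Hm HF]|[Hm HF]]).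
    + exists l'; split; [|auto].
      apply sublist_skip; eapply sublist_trans; [eassumption|apply sublist_filter].
    + exists (x :: l'); split.
      { apply sublist_cons; eapply sublist_trans; [eassumption|apply sublist_filter]. }
      right; simpl; split; [lia|]; constructor; auto.
      apply Forall_forall; intros y Hy; apply (sublist_incl _ _ Hs), filter_In in Hy.
      apply decb_false, Hy.
Qed.

Lemma ramsey_colours (k m : nat) : exists n, forall (A : Type) (col : A -> A -> nat) (l : list A),
  n <= length l -> ForallOrdPairs (fun x y => col x y < k) l ->
  exists c l', c < k /\ sublist l' l /\ length l' = m /\
    ForallOrdPairs (fun x y => col x y = c) l'.
Proof.
  induction k as [|k [n IH]].
  (* With no colours, a list of two members already contradicts the hypothesis. *)
  { exists 2; intros A col [|x [|y l]] Hl HF; simpl in Hl; try lia.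
    inversion HF as [|? ? Hx ?]; inversion Hx; lia. }
  destruct (ramsey m n) as [N HN]; exists N; intros A col l Hl HF.
  destruct (HN A (fun x y => col x y = k) l Hl) as (l' & Hs & [[Hm H]|[Hm H]]).
  - exists k, l'; auto.
  - pose proof (sublist_ForallOrdPairs _ _ _ Hs HF) as HF'.
    destruct (IH A col l') as (c & l'' & Hc & Hs' & Hm' & H'); [lia| |].
    + clear - H HF'; induction H as [|x l Hx H IH]; constructor; inversion HF'; subst; auto.
      rewrite Forall_forall in *; intros y Hy.
      specialize (Hx y Hy); specialize (H2 y Hy); simpl in *; lia.
    + exists c, l''; repeat split; auto; eapply sublist_trans; eauto.
Qed.

Lemma pigeonhole {A B} (R : A -> B -> Prop) (t : nat) (bs : list B) (l : list A) :
  (forall x, In x l -> exists b, In b bs /\ R x b) -> length bs * t < length l ->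
  exists b l', In b bs /\ sublist l' l /\ t < length l' /\ forall x, In x l' -> R x b.
Proof.
  revert l; induction bs as [|b bs IH]; intros l HR Hl; simpl in Hl.
  { destruct l as [|x l]; [simpl in Hl; lia|].
    destruct (HR x (or_introl eq_refl)) as (b & [] & _). }
  pose (f := fun x => decb (R x b)).
  pose proof (filter_length f l) as Hf.
  destruct (le_lt_dec (length (filter f l)) t) as [Ht|Ht].
  - destruct (IH (filter (fun x => negb (f x)) l)) as (b' & l' & Hb & Hs & Hl' & H').
    + intros x Hx; apply filter_In in Hx; destruct Hx as [Hx Hnx].
      apply decb_false in Hnx.
      destruct (HR x Hx) as (b' & [<-|Hb'] & HRb); [contradiction|eauto].
    + lia.
    + exists b', l'; repeat split; simpl; auto.
      eapply sublist_trans; [eassumption|apply sublist_filter].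
  - exists b, (filter f l); repeat split; simpl; auto using sublist_filter.
    intros x Hx; apply filter_In in Hx; apply decb_true, Hx.
Qed.

Lemma remove_sparse {A W} (touch : A -> W -> Prop) (d : nat) (ws : list W) (l : list A) :
  (forall w l', sublist l' l -> (forall x, In x l' -> touch x w) -> length l' <= d) ->
  exists l', sublist l' l /\ length l <= length l' + length ws * d /\
    forall w x, In w ws -> In x l' -> ~ touch x w.
Proof.
  intros Hd; induction ws as [|w ws (l' & Hs & Hl & H)].
  { exists l; split; [apply sublist_refl|split; [lia|intros ? ? []]]. }
  pose (f := fun x => decb (touch x w)).
  exists (filter (fun x => negb (f x)) l'); split; [|split].
  - eapply sublist_trans; [apply sublist_filter|auto].
  - pose proof (filter_length f l').
    assert (length (filter f l') <= d).
    { apply (Hd w); [eapply sublist_trans; [apply sublist_filter|auto]|].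
      intros x Hx; apply filter_In in Hx; apply decb_true, Hx. }
    simpl; lia.
  - intros w' x [<-|Hw] Hx; apply filter_In in Hx; [apply decb_false, Hx|apply H; tauto].
Qed.

(** Without [t] disjoint sets, Ramsey's theorem gives many sets that pairwise meet. They all meet
    the first one, so one of its at most [S k] elements lies in many of them; it joins the core and
    is removed from the sets, which lowers [k]. *)
Lemma sunflower (k t : nat) : exists n, forall (A V : Type) (s : A -> list V) (l : list A),
  n <= length l -> (forall x, In x l -> length (s x) <= k) ->
  exists core l', length core <= k /\ sublist l' l /\ t <= length l' /\
    forall x y, In x l' -> In y l' -> x <> y -> forall v, In v (s x) -> In v (s y) -> In v core.
Proof.
  induction k as [|k [n IH]].
  { exists t; intros A V s l Hl Hk; exists [], l; repeat split; auto using sublist_refl.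
    intros x y Hx _ _ v Hv; specialize (Hk x Hx); destruct (s x); [destruct Hv|simpl in Hk; lia]. }
  (* One member becomes [x0]; strictly more than [S k * n] others remain for the pigeonhole
     principle. *)
  destruct (ramsey t (S (S (S k * n)))) as [N HN]; exists N; intros A V s l Hl Hk.
  destruct (HN A (fun x y => forall v, In v (s x) -> In v (s y) -> False) l Hl)
    as (l' & Hs & [[Hm H]|[Hm H]]).
  - exists [], l'; repeat split; auto; [simpl; lia|lia|].
    intros x y Hx Hy Hxy v Hvx Hvy.
    refine (False_ind _ (ForallOrdPairs_sym H _ x y Hx Hy Hxy v Hvx Hvy)); eauto.
  - destruct l' as [|x0 l']; [simpl in Hm; lia|].
    inversion H as [|? ? Hx0 H']; subst; rewrite Forall_forall in Hx0.
    assert (Hk0 : length (s x0) <= S k) by (apply Hk, (sublist_incl _ _ Hs); simpl; auto).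
    destruct (pigeonhole (fun x v => In v (s x)) n (s x0) l') as (v & l2 & Hv & Hs2 & Hl2 & Hv2).
    + intros x Hx; apply NNPP; intros Hn; apply (Hx0 x Hx); intros v H1 H2; apply Hn; eauto.
    + simpl in Hm; nia.
    + assert (Hs2' : sublist l2 l).
      { eapply sublist_trans; [exact Hs2|]; eapply sublist_trans; [|exact Hs].
        apply sublist_skip, sublist_refl. }
      pose (s' := fun x => filter (fun u => negb (decb (u = v))) (s x)).
      destruct (IH A V s' l2) as (core & l3 & Hc & Hs3 & Hl3 & Hcore); [lia| |].
      * intros x Hx; pose proof (filter_length (fun u => decb (u = v)) (s x)) as Hf.
        assert (0 < length (filter (fun u => decb (u = v)) (s x))).
        { specialize (Hv2 x Hx).
          assert (Hin : In v (filter (fun u => decb (u = v)) (s x)))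
            by (apply filter_In; rewrite decb_true; auto).
          destruct (filter _ (s x)); [destruct Hin|simpl; lia]. }
        specialize (Hk x (sublist_incl _ _ Hs2' _ Hx)); unfold s'; lia.
      * exists (v :: core), l3; repeat split; simpl; auto; [lia|eapply sublist_trans; eauto|].
        intros x y Hx Hy Hxy u Hux Huy.
        destruct (classic (u = v)) as [->|Hne]; [auto|right].
        apply (Hcore x y Hx Hy Hxy); apply filter_In; rewrite decb_false; auto.
Qed.

(** * Bounded reachability and scattering in sparse graphs *)

Section Reach.
Context {V : Type} (E : V -> V -> Prop).

Lemma reach_mono (P P' : V -> Prop) n n' x y :
  (forall z, P z -> P' z) -> n <= n' -> reach P E n x y -> reach P' E n' x y.
Proof.
  intros HP Hn H; revert n' Hn; induction H as [n x Hx|n x y z Hx Hxy H IH]; intros n' Hn.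
  - apply reach0; auto.
  - destruct n' as [|n']; [lia|]; eapply reachS; eauto; apply IH; lia.
Qed.

Lemma reach_start (P : V -> Prop) n x y : reach P E n x y -> P x.
Proof. destruct 1; auto. Qed.

Lemma reach_end (P : V -> Prop) n x y : reach P E n x y -> P y.
Proof. induction 1; auto. Qed.

Lemma reach_trans (P : V -> Prop) n m x y z :
  reach P E n x y -> reach P E m y z -> reach P E (n + m) x z.
Proof.
  intros H; revert m z; induction H as [n x Hx|n x y z Hx Hxy H IH]; intros m w Hw.
  - apply (reach_mono P P m); auto; lia.
  - simpl; eapply reachS; eauto.
Qed.

Lemma reach_snoc (P : V -> Prop) n x y z :
  reach P E n x y -> E y z -> P z -> reach P E (S n) x z.
Proof.
  intros H Hyz Hz; replace (S n) with (n + 1) by lia.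
  apply reach_trans with y; auto.
  eapply reachS; [eapply reach_end; eauto|eauto|apply reach0; auto].
Qed.

Lemma reach_split (P : V -> Prop) a b x z :
  reach P E (a + b) x z -> exists y, reach P E a x y /\ reach P E b y z.
Proof.
  revert x; induction a as [|a IH]; intros x H.
  - exists x; split; auto; apply reach0; eapply reach_start; eauto.
  - simpl in H; inversion H as [n x0 Hx|n x0 y z0 Hx Hxy H']; subst.
    + exists z; split; apply reach0; auto.
    + destruct (IH y H') as (w & Hw & Hw'); exists w; split; auto; eapply reachS; eauto.
Qed.

(** With [a = 0] this makes a ball of radius [b] a branch set of radius [b]: its walks from the
    centre stay inside it. *)
Lemma reach_within_ball (P : V -> Prop) a b c x y :
  reach P E a c x -> reach P E b x y -> reach (reach P E (a + b) c) E b x y.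
Proof.
  intros Ha Hb; revert a Ha; induction Hb as [n x Hx|n x y z Hx Hxy H IH]; intros a Ha.
  - apply reach0; apply (reach_mono P P a); auto; lia.
  - eapply reachS; [apply (reach_mono P P a); auto; lia|eauto|].
    replace (a + S n) with (S a + n) by lia.
    apply IH; eapply reach_snoc; eauto; eapply reach_start; eauto.
Qed.

Context (E_sym : forall x y, E x y -> E y x).

Lemma reach_sym (P : V -> Prop) n x y : reach P E n x y -> reach P E n y x.
Proof.
  induction 1 as [n x Hx|n x y z Hx Hxy H IH]; [apply reach0; auto|].
  eapply reach_snoc; eauto.
Qed.
End Reach.

Lemma reach_edges {V} (P : V -> Prop) (E E' : V -> V -> Prop) n x y :
  (forall x y, P x -> P y -> E x y -> E' x y) -> reach P E n x y -> reach P E' n x y.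
Proof.
  intros HE; induction 1 as [n x Hx|n x y z Hx Hxy H IH]; [apply reach0; auto|].
  eapply reachS; eauto; apply HE; auto; eapply reach_start; eauto.
Qed.

(** A clique as an [r]-minor, freed from the subgraph and the contraction map of [rminor]: only
    disjoint branch sets of radius [r] with an edge between any two of them. *)
Definition shallow_clique {V : Type} (E : V -> V -> Prop) (r t : nat) : Prop :=
  exists U : nat -> V -> Prop,
    (forall i, i < t -> exists c, U i c /\ forall y, U i y -> reach (U i) E r c y) /\
    (forall i j, i < t -> j < t -> i <> j ->
       (forall x, U i x -> U j x -> False) /\ exists x y, U i x /\ U j y /\ E x y).

Definition sparse {V : Type} (E : V -> V -> Prop) (bound : nat -> nat) : Prop :=
  forall r t, shallow_clique E r t -> t <= bound r.

Lemma shallow_clique_of_list {A V} (E : V -> V -> Prop) (l : list A)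
    (U : A -> V -> Prop) (c : A -> V) (r : nat) :
  (forall x y, E x y -> E y x) -> NoDup l ->
  (forall i, In i l -> U i (c i) /\ forall y, U i y -> reach (U i) E r (c i) y) ->
  (forall i j, In i l -> In j l -> i <> j -> forall x, U i x -> U j x -> False) ->
  ForallOrdPairs (fun i j => exists x y, U i x /\ U j y /\ E x y) l ->
  shallow_clique E r (length l).
Proof.
  intros Es Hn HU Hd HE.
  exists (fun i x => exists a, nth_error l i = Some a /\ U a x); split.
  - intros i Hi; apply nth_error_Some in Hi; destruct (nth_error l i) as [a|] eqn:Ha; [|congruence].
    destruct (HU a (nth_error_In _ _ Ha)) as [H1 H2].
    exists (c a); split; [eauto|]; intros y (b & Hb & Hy).
    replace b with a in * by congruence.
    eapply reach_mono; [|constructor|apply H2; auto]; eauto.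
  - intros i j Hi Hj Hij.
    apply nth_error_Some in Hi; destruct (nth_error l i) as [a|] eqn:Ha; [|congruence].
    apply nth_error_Some in Hj; destruct (nth_error l j) as [b|] eqn:Hb; [|congruence].
    assert (Hab : a <> b).
    { intros <-; apply Hij; apply (proj1 (NoDup_nth_error l) Hn); [|congruence].
      apply nth_error_Some; congruence. }
    assert (Hia := nth_error_In _ _ Ha); assert (Hib := nth_error_In _ _ Hb).
    split.
    + intros x (a' & Ha' & Hx) (b' & Hb' & Hx').
      replace a' with a in * by congruence; replace b' with b in * by congruence; eauto.
    + destruct (ForallOrdPairs_sym HE) with (x := a) (y := b)
        as (x & y & Hx & Hy & Hxy); eauto.
      * intros a' b' (x & y & ? & ? & ?); exists y, x; auto.
      * exists x, y; repeat split; eauto.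
Qed.

(* It is enough that elements owned by different members are distinct: each branch
   set of the clique minor built from them may own several. *)
Lemma own_greedy (d t : nat) : forall p, exists n,
  forall (A W : Type) (touch : A -> W -> Prop) (sel rem : list A),
  length sel = p -> n <= length rem -> NoDup rem ->
  (forall i j, In i (sel ++ rem) -> In j rem -> i <> j -> exists w, touch i w /\ touch j w) ->
  (forall i, In i sel -> ~ In i rem) ->
  (forall w l', sublist l' rem -> (forall x, In x l' -> touch x w) -> length l' <= d) ->
  exists l' (Own : A -> W -> Prop), sublist l' rem /\ length l' = t /\
    (forall j w, In j l' -> Own j w -> touch j w) /\
    (forall i j w, In i l' -> In j l' -> Own i w -> Own j w -> i = j) /\
    ForallOrdPairs (fun i j => exists w, Own j w /\ touch i w) l' /\
    (forall i j, In i sel -> In j l' -> exists w, Own j w /\ touch i w).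
Proof.
  induction t as [|t IH]; intros p.
  { exists 0; intros; exists [], (fun _ _ => False); repeat split; try (intros; simpl in *; tauto); constructor. }
  (* The first member [x] is selected and owns one common element with each of the [p] members
     selected before. Each of these elements is touched by at most [d] members; dropping those costs
     at most [p * d] and keeps what later members own disjoint from what [x] owns. *)
  destruct (IH (S p)) as [n Hn]; exists (S (n + p * d)).
  intros A W touch sel [|x rem] Hp Hl Hnd Hcom Hsel Hd; simpl in Hl; [lia|].
  inversion Hnd as [|? ? Hxr Hnr]; subst.
  assert (Hws : exists ws, length ws = length sel /\ (forall w, In w ws -> touch x w) /\
             forall i, In i sel -> exists w, In w ws /\ touch i w).
  { assert (Hall : forall i, In i sel -> exists w, touch i w /\ touch x w).
    { intros i Hi; apply Hcom; [apply in_or_app; auto|simpl; auto|].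
      intros ->; eapply Hsel; simpl; eauto. }
    clear - Hall; induction sel as [|i sel IHs].
    - exists []; simpl; intuition.
    - destruct IHs as (ws & H1 & H2 & H3); [intros; apply Hall; simpl; auto|].
      destruct (Hall i) as (w & Hw & Hw'); [simpl; auto|].
      exists (w :: ws); simpl; repeat split; [lia|intros ? [<-|?]; auto|].
      intros j [<-|Hj]; [eauto|]; destruct (H3 j Hj) as (w' & ? & ?); eauto. }
  destruct Hws as (ws & Hwl & Hwx & Hws).
  destruct (remove_sparse touch d ws rem) as (rem' & Hs & Hl' & Hr).
  { intros w l' Hl' Ht; apply (Hd w); auto; apply sublist_skip; auto. }
  destruct (Hn A W touch (x :: sel) rem') as (l' & Own & Hs' & Ht & H1 & H2 & H3 & H4).
  - reflexivity.
  - nia.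
  - eapply sublist_NoDup; eauto.
  - intros i j Hi Hj Hij; apply (sublist_incl _ _ Hs) in Hj.
    apply Hcom; simpl; auto; apply in_or_app; simpl in *.
    destruct Hi as [<-|Hi]; [auto|apply in_app_or in Hi; destruct Hi as [Hi|Hi]; auto].
    right; right; apply (sublist_incl _ _ Hs); auto.
  - intros i [<-|Hi] Hir; apply (sublist_incl _ _ Hs) in Hir; [auto|].
    eapply Hsel; simpl; eauto.
  - intros w l' Hl2; apply Hd, sublist_skip; eapply sublist_trans; eauto.
  - assert (Hne : forall j, In j l' -> j <> x).
    { intros j Hj ->; apply Hxr, (sublist_incl _ _ Hs), (sublist_incl _ _ Hs'); auto. }
    exists (x :: l'), (fun j w => (j = x /\ In w ws) \/ (j <> x /\ Own j w)).
    repeat split.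
    + apply sublist_cons; eapply sublist_trans; eauto.
    + simpl; lia.
    + intros j w Hj [[-> Hw]|[Hjx Hw]]; auto.
      destruct Hj as [->|Hj]; [congruence|auto].
    + intros i j w Hi Hj [[-> Hw]|[Hix Hw]] [[-> Hw']|[Hjx Hw']]; auto.
      * exfalso; destruct Hj as [->|Hj]; [congruence|].
        apply (Hr w j Hw); [apply (sublist_incl _ _ Hs'); auto|auto].
      * exfalso; destruct Hi as [->|Hi]; [congruence|].
        apply (Hr w i Hw'); [apply (sublist_incl _ _ Hs'); auto|auto].
      * destruct Hi as [->|Hi]; [congruence|]; destruct Hj as [->|Hj]; [congruence|]; eauto.
    + constructor.
      * apply Forall_forall; intros j Hj; destruct (H4 x j) as (w & ? & ?); simpl; auto.
        exists w; auto.
      * eapply ForallOrdPairs_impl; [|exact H3].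
        intros i j Hi Hj (w & ? & ?); exists w; auto.
    + intros i j Hi [<-|Hj].
      * destruct (Hws i Hi) as (w & ? & ?); exists w; auto.
      * destruct (H4 i j) as (w & ? & ?); simpl; auto.
        exists w; auto.
Qed.

(* Common neighbours of many members are split off one at a time, [T] of them at
   most; once every element touches few members, Ramsey's theorem and
   [own_greedy] apply. *)
Lemma touch_dichotomy (m t : nat) : forall T, exists n,
  forall (A W : Type) (touch : A -> W -> Prop) (l : list A), NoDup l -> n <= length l ->
  (exists F l', length F <= T /\ sublist l' l /\ m <= length l' /\
     forall w i j, ~ In w F -> In i l' -> In j l' -> touch i w -> touch j w -> i = j) \/
  (exists l' (Own : A -> W -> Prop), sublist l' l /\ length l' = S t /\
    (forall j w, In j l' -> Own j w -> touch j w) /\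
    (forall i j w, In i l' -> In j l' -> Own i w -> Own j w -> i = j) /\
    ForallOrdPairs (fun i j => exists w, Own j w /\ touch i w) l') \/
  (exists ws l', NoDup ws /\ length ws = T /\ sublist l' l /\ length l' = S t /\
     forall i w, In i l' -> In w ws -> touch i w).
Proof.
  induction T as [|T [n IH]].
  { exists (S t); intros A W touch l Hn Hl; right; right; exists [], (firstn (S t) l).
    repeat split; [constructor|apply sublist_firstn|rewrite length_firstn; lia|intros ? ? ? []]. }
  (* [n] doubles as the bound [d] on the members touching one element: an element touched by [n] or
     more is split off. *)
  destruct (own_greedy n (S t) 0) as [K HK].
  destruct (ramsey K m) as [N HN].
  exists N; intros A W touch l Hn Hl.
  destruct (classic (exists w l', sublist l' l /\ n <= length l' /\ forall x, In x l' -> touch x w))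
    as [(w & l1 & Hs1 & Hl1 & Hw)|Hno].
  - destruct (IH A W (fun i w' => touch i w' /\ w' <> w) l1) as [H|[H|H]]; auto.
    + eapply sublist_NoDup; eauto.
    + destruct H as (F & l' & HF & Hs & Hm & H); left; exists (w :: F), l'.
      repeat split; [simpl; lia|eapply sublist_trans; eauto|auto|].
      intros w' i j Hw' Hi Hj Hti Htj; simpl in Hw'.
      apply (H w' i j); auto; split; auto.
    + destruct H as (l' & Own & Hs & Ht & H1 & H2 & H3); right; left; exists l', Own.
      repeat split; auto; [eapply sublist_trans; eauto|intros; eapply H1; eauto|].
      eapply ForallOrdPairs_impl; [|exact H3]; intros i j _ _ (w' & ? & ? & ?); eauto.
    + destruct H as (ws & l' & Hnd & HT & Hs & Ht & H); right; right; exists (w :: ws), l'.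
      repeat split; simpl; auto; [|eapply sublist_trans; eauto|].
      * constructor; auto; intros Hin; destruct l' as [|i l'].
        -- discriminate.
        -- destruct (H i w) as [_ ?]; simpl; auto.
      * intros i w' Hi [<-|Hw']; [apply Hw, (sublist_incl _ _ Hs); auto|apply H; auto].
  - destruct (HN A (fun i j => exists w, touch i w /\ touch j w) l Hl) as (l' & Hs & [[Hl' H]|[Hl' H]]).
    + right; left.
      destruct (HK A W touch [] l') as (l2 & Own & Hs2 & Ht & H1 & H2 & H3 & _); auto.
      * lia.
      * eapply sublist_NoDup; eauto.
      * intros i j Hi Hj Hij; apply (ForallOrdPairs_sym H); auto.
        intros ? ? (w & ? & ?); eauto.
      * intros w l2 Hs2 Hw; destruct (le_lt_dec (length l2) n); auto.
        exfalso; apply Hno; exists w, l2; repeat split; auto; [eapply sublist_trans; eauto|lia].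
      * exists l2, Own; repeat split; auto; eapply sublist_trans; eauto.
    + left; exists [], l'; repeat split; simpl; auto; [lia|lia|].
      intros w i j _ Hi Hj Hti Htj; apply NNPP; intros Hij.
      apply (ForallOrdPairs_sym H) with (x := i) (y := j); eauto.
      intros a b Hab (w' & ? & ?); apply Hab; eauto.
Qed.

(** For [T = S t] the third outcome is a complete bipartite graph with [S t] vertices on each side;
    giving the [p]-th element to the [p]-th member turns it into the second outcome. *)
Lemma touch_alternative (m t : nat) : exists n,
  forall (A W : Type) (touch : A -> W -> Prop) (l : list A), NoDup l -> n <= length l ->
  (exists F l', length F <= S t /\ sublist l' l /\ m <= length l' /\
     forall w i j, ~ In w F -> In i l' -> In j l' -> touch i w -> touch j w -> i = j) \/
  (exists l' (Own : A -> W -> Prop), sublist l' l /\ length l' = S t /\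
    (forall j w, In j l' -> Own j w -> touch j w) /\
    (forall i j w, In i l' -> In j l' -> Own i w -> Own j w -> i = j) /\
    ForallOrdPairs (fun i j => exists w, Own j w /\ touch i w) l').
Proof.
  destruct (touch_dichotomy m t (S t)) as [n H]; exists n.
  intros A W touch l Hn Hl; destruct (H A W touch l Hn Hl) as [?|[?|Hc]]; auto.
  destruct Hc as (ws & l' & Hnd & HT & Hs & Ht & Hc); right.
  exists l', (fun j w => exists p, nth_error l' p = Some j /\ nth_error ws p = Some w).
  repeat split; auto.
  - intros j w Hj (p & _ & Hp); apply Hc; auto; eapply nth_error_In; eauto.
  - intros i j w Hi Hj (p & Hp & Hpw) (q & Hq & Hqw).
    assert (p = q); [|congruence].
    apply (proj1 (NoDup_nth_error ws) Hnd); [|congruence].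
    apply nth_error_Some; congruence.
  - apply ForallOrdPairs_all; intros i j Hi Hj; destruct (In_nth_error _ _ Hj) as [p Hp].
    assert (Hpl : p < length ws)
      by (rewrite HT, <- Ht; apply nth_error_Some; congruence).
    apply nth_error_Some in Hpl; destruct (nth_error ws p) as [w|] eqn:Hw; [|congruence].
    exists w; split; [eauto|apply Hc; auto; eapply nth_error_In; eauto].
Qed.

(** * Scattering vertices and tuples by deleting few vertices *)

Notation avoiding F := (fun z => ~ In z F).

Definition scattered {A V : Type} (E : V -> V -> Prop) (F : list V) (r : nat)
    (d : A -> V) (l : list A) : Prop :=
  (forall i, In i l -> ~ In (d i) F) /\
  forall i j, In i l -> In j l -> i <> j -> ~ reach (avoiding F) E r (d i) (d j).

Lemma scattered_sublist {A V} (E : V -> V -> Prop) F r (d : A -> V) l l' :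
  sublist l' l -> scattered E F r d l -> scattered E F r d l'.
Proof. intros Hs [H1 H2]; apply sublist_incl in Hs; split; auto. Qed.

(** Balls of radius [rho] are disjoint. More than [bound rho] pairwise adjacent ones would form too
    large a clique minor, so Ramsey's theorem leaves balls without edges between them, and their
    centres are one step further apart. The hypothesis on [n] is an instance of [ramsey], so that
    [n] is fixed before the graph is given. *)
Lemma scatter_odd {V : Type} (E : V -> V -> Prop) (bound : nat -> nat) (rho m : nat) :
  (forall x y, E x y -> E y x) -> sparse E bound ->
  forall n, (forall (A : Type) (R : A -> A -> Prop) (l : list A),
  n <= length l -> exists l', sublist l' l /\
    ((length l' = S (bound rho) /\ ForallOrdPairs R l') \/
     (length l' = m /\ ForallOrdPairs (fun x y => ~ R x y) l'))) ->
  forall (A : Type) (d : A -> V) F l, NoDup l -> n <= length l ->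
    scattered E F (2 * rho) d l ->
    exists l', sublist l' l /\ m <= length l' /\ scattered E F (S (2 * rho)) d l'.
Proof.
  intros Es Hsp n HR A d F l Hnd Hl [HdF Hsc].
  pose (U := fun i => reach (avoiding F) E rho (d i)).
  assert (HUd : forall i j, In i l -> In j l -> i <> j -> forall x, U i x -> U j x -> False).
  { intros i j Hi Hj Hij x Hxi Hxj; apply (Hsc i j Hi Hj Hij).
    replace (2 * rho) with (rho + rho) by lia.
    apply reach_trans with x; auto; apply reach_sym; auto. }
  destruct (HR A (fun i j => exists x y, U i x /\ U j y /\ E x y) l Hl)
    as (l' & Hs & [[Hm H]|[Hm H]]).
  - exfalso.
    assert (Hc : shallow_clique E rho (length l')).
    { apply shallow_clique_of_list with (U := U) (c := d); auto.
      - eapply sublist_NoDup; eauto.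
      - intros i Hi; split.
        + apply reach0; apply HdF, (sublist_incl _ _ Hs); auto.
        + intros y Hy; refine (reach_within_ball E (avoiding F) 0 rho (d i) (d i) y _ Hy).
          apply reach0; exact (reach_start _ _ _ _ _ Hy).
      - intros i j Hi Hj; apply HUd; apply (sublist_incl _ _ Hs); auto. }
    apply Hsp in Hc; lia.
  - exists l'; split; [auto|split; [lia|]].
    destruct (scattered_sublist E F (2 * rho) d l l' Hs (conj HdF Hsc)) as [HdF' Hsc'].
    split; auto; intros i j Hi Hj Hij Hr.
    replace (S (2 * rho)) with (rho + S rho) in Hr by lia.
    destruct (reach_split _ _ _ _ _ _ Hr) as (y & Hy & Hy').
    inversion Hy' as [n' x' Hx'|n' x' y' z' Hx' Hxy Hz]; subst.
    + apply (Hsc' i j Hi Hj Hij); eapply reach_mono; [| |exact Hy]; auto; lia.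
    + refine (ForallOrdPairs_sym H _ i j Hi Hj Hij _).
      * intros a b Hab (x & x' & ? & ? & ?); apply Hab; exists x', x; auto.
      * exists y, y'; repeat split; auto; apply reach_sym; auto.
Qed.

(** Balls of radius [rho] are now disjoint and not adjacent, so a walk of length [2 * rho + 2]
    between two centres has its middle vertex outside all balls, and this vertex touches two of
    them. Either a few vertices account for all such contacts and are deleted, or owned contact
    vertices enlarge too many balls to pairwise adjacent branch sets of radius [S rho]. *)
Lemma scatter_even {V : Type} (E : V -> V -> Prop) (bound : nat -> nat) (rho m : nat) :
  (forall x y, E x y -> E y x) -> sparse E bound ->
  forall n s, (forall (A W : Type) (touch : A -> W -> Prop) (l : list A),
  NoDup l -> n <= length l ->
  (exists F l', length F <= s /\ sublist l' l /\ m <= length l' /\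
     forall w i j, ~ In w F -> In i l' -> In j l' -> touch i w -> touch j w -> i = j) \/
  (exists l' (Own : A -> W -> Prop), sublist l' l /\ length l' = S (bound (S rho)) /\
    (forall j w, In j l' -> Own j w -> touch j w) /\
    (forall i j w, In i l' -> In j l' -> Own i w -> Own j w -> i = j) /\
    ForallOrdPairs (fun i j => exists w, Own j w /\ touch i w) l')) ->
  forall (A : Type) (d : A -> V) F l, NoDup l -> n <= length l ->
    scattered E F (S (2 * rho)) d l ->
    exists F' l', length F' <= s /\ sublist l' l /\ m <= length l' /\
      scattered E (F ++ F') (S (S (2 * rho))) d l'.
Proof.
  intros Es Hsp n s HT A d F l Hnd Hl [HdF Hsc].
  pose (U := fun i => reach (avoiding F) E rho (d i)).
  assert (HUd : forall i j, In i l -> In j l -> i <> j -> forall x, U i x -> U j x -> False).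
  { intros i j Hi Hj Hij x Hxi Hxj; apply (Hsc i j Hi Hj Hij).
    apply reach_mono with (P := avoiding F) (n := rho + rho); auto; [lia|].
    apply reach_trans with x; auto; apply reach_sym; auto. }
  assert (HUe : forall i j, In i l -> In j l -> i <> j -> forall x y, U i x -> U j y -> E x y -> False).
  { intros i j Hi Hj Hij x y Hxi Hxj Hxy; apply (Hsc i j Hi Hj Hij).
    replace (S (2 * rho)) with (rho + S rho) by lia.
    apply reach_trans with x; auto; apply reachS with y; auto.
    - exact (reach_end _ _ _ _ _ Hxi).
    - apply reach_sym; auto. }
  pose (touch := fun i w => (forall k, In k l -> ~ U k w) /\ exists x, U i x /\ E x w).
  destruct (HT A V touch l Hnd Hl) as [(F0 & l' & HF0 & Hs & Hm & H)|(l' & Own & Hs & Ht & H1 & H2 & H3)].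
  (* Only vertices outside all balls are deleted, so no centre is lost; the others in [F0] touch
     nothing. *)
  - pose (F' := filter (fun w => decb (forall k, In k l -> ~ U k w)) F0).
    assert (HF' : forall w, In w F' <-> In w F0 /\ forall k, In k l -> ~ U k w)
      by (intros w; unfold F'; rewrite filter_In, decb_true; reflexivity).
    assert (Hinc := sublist_incl _ _ Hs).
    exists F', l'; split; [|split; [auto|split; [auto|split]]].
    + unfold F'; pose proof (filter_length_le (fun w => decb (forall k, In k l -> ~ U k w)) F0); lia.
    + intros i Hi Hin; apply in_app_or in Hin; destruct Hin as [Hin|Hin].
      * apply (HdF i); auto.
      * apply HF' in Hin; destruct Hin as [_ Hin]; apply (Hin i); auto; apply reach0; auto.
    + intros i j Hi Hj Hij Hr.
      assert (Hmono : forall k x y, reach (avoiding (F ++ F')) E k x y -> reach (avoiding F) E k x y).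
      { intros k x y; apply reach_mono; auto; intros z Hz Hz'; apply Hz, in_or_app; auto. }
      replace (S (S (2 * rho))) with (rho + S (S rho)) in Hr by lia.
      destruct (reach_split _ _ _ _ _ _ Hr) as (y & Hy & Hy').
      inversion Hy' as [n' x' Hx'|n' x' y' z' Hx' Hxy Hz]; subst.
      { apply (HUd i j) with (x := d j); auto; [apply Hmono; auto|apply reach0; auto]. }
      inversion Hz as [n' x' Hx''|n' x' w z' Hx'' Hxw Hw]; subst.
      { apply (HUe i j) with (x := y) (y := d j); auto; [apply Hmono; auto|apply reach0; auto]. }
      assert (Hiy : U i y) by (apply Hmono; auto).
      assert (Hjw : U j w) by (apply reach_sym, Hmono; auto).
      assert (Hout : forall k, In k l -> ~ U k y').
      { intros k Hk Hky; destruct (classic (k = i)) as [->|Hki].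
        - apply (HUe i j) with (x := y') (y := w); auto.
        - apply (HUe i k) with (x := y) (y := y'); auto. }
      apply Hij, (H y'); auto.
      * intros Hin; apply Hx''; apply in_or_app; right; apply HF'; auto.
      * split; eauto.
      * split; eauto.
  - exfalso.
    assert (Hinc := sublist_incl _ _ Hs).
    pose (U' := fun j x => U j x \/ (Own j x)).
    assert (Hc : shallow_clique E (S rho) (length l')).
    { apply shallow_clique_of_list with (U := U') (c := d); auto.
      - eapply sublist_NoDup; eauto.
      - assert (HUU : forall i, In i l' -> forall y, U i y -> reach (U' i) E rho (d i) y).
        { intros i Hi y Hy.
          apply reach_mono with (P := U i) (n := rho); [unfold U'; auto|auto|].
          refine (reach_within_ball E (avoiding F) 0 rho (d i) (d i) y _ Hy).
          apply reach0; exact (reach_start _ _ _ _ _ Hy). }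
        intros i Hi; split.
        + left; apply reach0; auto.
        + intros y [Hy|Hy].
          * apply reach_mono with (P := U' i) (n := rho); auto.
          * destruct (H1 i y Hi Hy) as (_ & x & Hx & Hxy).
            apply reach_snoc with x; auto; right; auto.
      - intros i j Hi Hj Hij x [Hx|Hx] [Hx'|Hx'].
        + apply (HUd i j) with x; auto.
        + destruct (H1 j x Hj Hx') as (Ho & _); apply (Ho i); auto.
        + destruct (H1 i x Hi Hx) as (Ho & _); apply (Ho j); auto.
        + apply Hij; eapply H2; eauto.
      - eapply ForallOrdPairs_impl; [|exact H3].
        intros i j Hi Hj (w & Hw & _ & x & Hx & Hxw); exists x, w; repeat split; auto.
        + left; auto.
        + right; auto. }
    apply Hsp in Hc; lia.
Qed.

(** The radius grows by one at a time, through [scatter_odd] and [scatter_even] in turn. Only the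
    steps to an even radius delete vertices, at most [S (bound (S rho))] each, whatever [m] is. *)
Lemma scatter (bound : nat -> nat) (r : nat) : exists s, forall m, exists n,
  forall (A V : Type) (E : V -> V -> Prop) (d : A -> V) (l : list A),
  (forall x y, E x y -> E y x) -> sparse E bound -> NoDup l -> n <= length l ->
  (forall i j, In i l -> In j l -> d i = d j -> i = j) ->
  exists F l', length F <= s /\ sublist l' l /\ m <= length l' /\ scattered E F r d l'.
Proof.
  induction r as [|r (s & IH)].
  - exists 0; intros m; exists m; intros A V E d l _ _ _ Hl Hinj; exists [], l.
    repeat split; auto using sublist_refl; intros i j Hi Hj Hij Hr.
    inversion Hr; subst; auto.
  - destruct (Nat.Even_or_Odd r) as [[rho ->]|[rho Hr]].
    + exists s; intros m; destruct (ramsey (S (bound rho)) m) as [n1 Hn1].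
      destruct (IH n1) as [n H]; exists n.
      intros A V E d l Es Hsp Hnd Hl Hinj.
      destruct (H A V E d l Es Hsp Hnd Hl Hinj) as (F & l1 & HF & Hs1 & Hl1 & Hsc).
      destruct (scatter_odd E bound rho m Es Hsp n1 Hn1 A d F l1) as (l2 & Hs2 & Hl2 & Hsc2); auto.
      { eapply sublist_NoDup; eauto. }
      exists F, l2; repeat split; auto; try apply Hsc2; eapply sublist_trans; eauto.
    + replace r with (S (2 * rho)) in * by lia; clear Hr.
      exists (s + S (bound (S rho))); intros m.
      destruct (touch_alternative m (bound (S rho))) as [n1 Hn1].
      destruct (IH n1) as [n H]; exists n.
      intros A V E d l Es Hsp Hnd Hl Hinj.
      destruct (H A V E d l Es Hsp Hnd Hl Hinj) as (F & l1 & HF & Hs1 & Hl1 & Hsc).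
      destruct (scatter_even E bound rho m Es Hsp n1 _ Hn1 A d F l1)
        as (F' & l2 & HF' & Hs2 & Hl2 & Hsc2); auto.
      { eapply sublist_NoDup; eauto. }
      exists (F ++ F'), l2; rewrite length_app; repeat split; auto; try apply Hsc2;
        [lia|eapply sublist_trans; eauto].
Qed.

(** For each [u] the relation is a partial function of [i] on distinct members. Three members with
    every earlier one related to every later one would give the first two values, and with the
    relation reversed the last; so Ramsey's theorem, applied once for each direction, leaves
    unrelated members. *)
Lemma avoid_functional (L m : nat) : exists n,
  forall (A : Type) (P : nat -> A -> A -> Prop) (l : list A), NoDup l -> n <= length l ->
  (forall u i j j', u < L -> In i l -> In j l -> In j' l -> i <> j -> i <> j' -> j <> j' ->
     P u i j -> P u i j' -> False) ->
  exists l', sublist l' l /\ m <= length l' /\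
    forall u i j, u < L -> In i l' -> In j l' -> i <> j -> ~ P u i j.
Proof.
  induction L as [|L [n IH]].
  { exists m; intros A P l _ Hl _; exists l; repeat split; auto using sublist_refl; lia. }
  destruct (ramsey 3 n) as [n1 Hn1]; destruct (ramsey 3 n1) as [n2 Hn2].
  exists n2; intros A P l Hnd Hl Hf.
  destruct (Hn2 A (P L) l Hl) as (l1 & Hs1 & [[Hl1 H1]|[Hl1 H1]]).
  { exfalso; destruct l1 as [|a [|b [|c [|? ?]]]]; try discriminate.
    pose proof (sublist_NoDup _ _ Hs1 Hnd) as Hn; apply sublist_incl in Hs1.
    inversion H1 as [|? ? Ha _]; subst; rewrite Forall_forall in Ha.
    inversion Hn as [|? ? Ha' Hn']; inversion Hn' as [|? ? Hb' _]; subst; simpl in *.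
    apply (Hf L a b c); auto; try apply Hs1; simpl; auto; intros ->; tauto. }
  destruct (Hn1 A (fun i j => P L j i) l1) as (l2 & Hs2 & [[Hl2 H2]|[Hl2 H2]]); [lia| |].
  { exfalso; destruct l2 as [|a [|b [|c [|? ?]]]]; try discriminate.
    pose proof (sublist_trans _ _ _ Hs2 Hs1) as Hs.
    pose proof (sublist_NoDup _ _ Hs Hnd) as Hn; apply sublist_incl in Hs.
    inversion H2 as [|? ? Ha H2']; inversion H2' as [|? ? Hb _]; subst.
    rewrite Forall_forall in Ha, Hb.
    inversion Hn as [|? ? Ha' Hn']; inversion Hn' as [|? ? Hb' _]; subst; simpl in *.
    apply (Hf L c a b); auto; try apply Hs; simpl; auto; intros ->; tauto. }
  assert (Hs : sublist l2 l) by (eapply sublist_trans; eauto).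
  assert (Hinc := sublist_incl _ _ Hs).
  destruct (IH A P l2) as (l3 & Hs3 & Hl3 & H3).
  { eapply sublist_NoDup; eauto. }
  { lia. }
  { intros u i j j' Hu Hi Hj Hj'; apply Hf; auto. }
  exists l3; repeat split; auto; [eapply sublist_trans; eauto|].
  intros u i j Hu Hi Hj Hij; destruct (Nat.eq_dec u L) as [->|Hne]; [|apply H3; auto; lia].
  apply (sublist_incl _ _ Hs3) in Hi, Hj.
  pose proof (sublist_ForallOrdPairs _ _ _ Hs2 H1) as H1'.
  refine (proj1 (ForallOrdPairs_sym (ForallOrdPairs_and _ _ _ H1' H2) _ i j Hi Hj Hij)).
  simpl; tauto.
Qed.

Definition tuples_far {A V : Type} (E : V -> V -> Prop) (F : list V) (L r : nat)
    (c : A -> nat -> V) (l : list A) : Prop :=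
  forall i j u v, In i l -> In j l -> i <> j -> u < L -> v < L ->
    ~ reach (avoiding F) E r (c i u) (c j v).

Lemma tuples_far_mono {A V} (E : V -> V -> Prop) F F' L r (c : A -> nat -> V) l l' :
  incl F F' -> incl l' l -> tuples_far E F L r c l -> tuples_far E F' L r c l'.
Proof.
  intros HF Hl H i j u v Hi Hj Hij Hu Hv Hr; apply (H i j u v); auto.
  eapply reach_mono; [| |exact Hr]; auto.
Qed.

(** Induction on the length of the tuples. If the new coordinate is constant on many tuples, its
    value is deleted. Otherwise its values are scattered to distance beyond [r + r]; then each
    vertex [c i u] is within [r] of at most one of them, and [avoid_functional] clears the pairs of
    an old and a new coordinate. *)
Lemma scatter_tuples (bound : nat -> nat) (r L : nat) : exists s, forall m, exists n,
  forall (A V : Type) (E : V -> V -> Prop) (c : A -> nat -> V) (l : list A),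
  (forall x y, E x y -> E y x) -> sparse E bound -> NoDup l -> n <= length l ->
  exists F l', length F <= s /\ sublist l' l /\ m <= length l' /\ tuples_far E F L r c l'.
Proof.
  induction L as [|L (s & IH)].
  { exists 0; intros m; exists m; intros A V E c l _ _ _ Hl; exists [], l.
    repeat split; auto using sublist_refl; intros i j u v _ _ _ Hu; lia. }
  destruct (scatter bound (r + r)) as (s2 & Hscat').
  exists (S (s + s2)); intros m.
  destruct (avoid_functional L m) as [n1 Hclean].
  destruct (Hscat' n1) as [n2 Hscat].
  destruct (ramsey (S m) n2) as [n3 Hram].
  destruct (IH n3) as [n HIH]; exists n.
  intros A V E c l Es Hsp Hnd Hl.
  destruct (HIH A V E c l Es Hsp Hnd Hl) as (F & l1 & HF & Hs1 & Hl1 & Hfar).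
  pose (d := fun i => c i L).
  destruct (Hram A (fun i j => d i = d j) l1 Hl1) as (l2 & Hs2 & [[Hl2 H2]|[Hl2 H2]]).
  - destruct l2 as [|i0 l2]; [discriminate|].
    assert (Hcst : forall i, In i (i0 :: l2) -> d i = d i0).
    { inversion H2 as [|? ? Hi0 _]; subst; rewrite Forall_forall in Hi0.
      intros i [<-|Hi]; auto; symmetry; auto. }
    (* The ends of a walk also avoid the deleted set, so deleting the common value settles every
       pair that involves the coordinate [L]. *)
    exists (d i0 :: F), (i0 :: l2); split; [simpl; lia|]; split; [eapply sublist_trans; eauto|].
    split; [lia|]; intros i j u v Hi Hj Hij Hu Hv Hr.
    destruct (Nat.eq_dec u L) as [->|Hu'].
    { apply (reach_start _ _ _ _ _ Hr); left; symmetry; apply Hcst; auto. }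
    destruct (Nat.eq_dec v L) as [->|Hv'].
    { apply (reach_end _ _ _ _ _ Hr); left; symmetry; apply Hcst; auto. }
    refine (tuples_far_mono E F (d i0 :: F) L r c l1 (i0 :: l2) _ _ Hfar i j u v Hi Hj Hij _ _ Hr);
      [apply incl_tl, incl_refl|apply sublist_incl; auto|lia|lia].
  - assert (Hs2' : sublist l2 l) by (eapply sublist_trans; eauto).
    destruct (Hscat A V E d l2) as (F2 & l3 & HF2 & Hs3 & Hl3 & Hsc); auto; [|lia| |].
    { eapply sublist_NoDup; eauto. }
    { intros i j Hi Hj Hij; apply NNPP; intros Hne.
      refine (ForallOrdPairs_sym H2 _ i j Hi Hj Hne Hij); auto. }
    assert (Hmono : forall k x y, reach (avoiding (F ++ F2)) E k x y -> reach (avoiding F2) E k x y).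
    { intros k x y; apply reach_mono; auto; intros z Hz Hz'; apply Hz, in_or_app; auto. }
    destruct (Hclean A (fun u i j => reach (avoiding (F ++ F2)) E r (c i u) (d j)) l3)
      as (l4 & Hs4 & Hl4 & H4); auto.
    { eapply sublist_NoDup; [exact Hs3|]; eapply sublist_NoDup; eauto. }
    { intros u i j j' Hu Hi Hj Hj' _ _ Hjj Hr Hr'.
      apply (proj2 Hsc j j' Hj Hj' Hjj), Hmono.
      apply reach_trans with (c i u); auto; apply reach_sym; auto. }
    assert (Hi43 := sublist_incl _ _ Hs4).
    exists (F ++ F2), l4; rewrite length_app; split; [lia|]; split; [|split; [auto|]].
    { eapply sublist_trans; [exact Hs4|]; eapply sublist_trans; eauto. }
    intros i j u v Hi Hj Hij Hu Hv Hr.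
    destruct (Nat.eq_dec v L) as [->|Hv'].
    + destruct (Nat.eq_dec u L) as [->|Hu'].
      * apply (proj2 Hsc i j); auto.
        apply Hmono; eapply reach_mono; [| |exact Hr]; auto; lia.
      * apply (H4 u i j); auto; lia.
    + destruct (Nat.eq_dec u L) as [->|Hu'].
      * apply (H4 v j i); auto; [lia|apply reach_sym; auto].
      * refine (tuples_far_mono E F (F ++ F2) L r c l1 l4 _ _ Hfar i j u v Hi Hj Hij _ _ Hr); [| |lia|lia].
        -- apply incl_appl, incl_refl.
        -- apply sublist_incl; eapply sublist_trans; [exact Hs4|]; eapply sublist_trans; eauto.
Qed.

(** * Types of bounded quantifier rank *)

Definition finite_index {X : Type} (N : nat) (R : X -> X -> Prop) : Prop :=
  exists code : X -> nat, (forall x, code x < N) /\ forall x y, code x = code y -> R x y.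

Lemma finite_index_pred {X} (P : X -> Prop) : finite_index 2 (fun x y => P x <-> P y).
Proof.
  exists (fun x => if decb (P x) then 1 else 0); split.
  - intros x; destruct (decb (P x)); lia.
  - intros x y; generalize (decb_true (P x)), (decb_true (P y)).
    destruct (decb (P x)), (decb (P y)); intros [H1 H2] [H3 H4] H; try discriminate; tauto.
Qed.

Lemma finite_index_and {X} N1 N2 (R1 R2 : X -> X -> Prop) :
  finite_index N1 R1 -> finite_index N2 R2 ->
  finite_index (N1 * N2) (fun x y => R1 x y /\ R2 x y).
Proof.
  intros (c1 & B1 & H1) (c2 & B2 & H2); exists (fun x => N2 * c1 x + c2 x); split.
  - intros x; specialize (B1 x); specialize (B2 x); nia.
  - intros x y H; apply Nat.div_mod_unique in H; auto.
    destruct H; auto.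
Qed.

Lemma finite_index_forall {X} L N (R : nat -> X -> X -> Prop) :
  (forall u, u < L -> finite_index N (R u)) ->
  finite_index (N ^ L) (fun x y => forall u, u < L -> R u x y).
Proof.
  induction L as [|L IH]; intros H.
  - exists (fun _ => 0); split; [simpl; lia|intros; lia].
  - destruct (finite_index_and N (N ^ L) (R L) _ (H L ltac:(lia)) (IH ltac:(auto)))
      as (c & B & Hc).
    exists c; split; [exact B|]; intros x y Hxy u Hu; destruct (Hc x y Hxy) as [H1 H2].
    destruct (Nat.eq_dec u L) as [->|]; auto; apply H2; lia.
Qed.

Lemma finite_index_pull {X Y} (f : Y -> X) N (R : X -> X -> Prop) :
  finite_index N R -> finite_index N (fun x y => R (f x) (f y)).
Proof. intros (c & B & H); exists (fun y => c (f y)); auto. Qed.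

Lemma finite_index_pair {X} N (R : X -> X -> Prop) (l : list X) :
  finite_index N R -> NoDup l -> N < length l ->
  exists x y, In x l /\ In y l /\ x <> y /\ R x y.
Proof.
  intros (c & B & H) Hn Hl.
  destruct (pigeonhole (fun x b => c x = b) 1 (seq 0 N) l) as (b & l' & _ & Hs & Hl' & Hb).
  - intros x _; exists (c x); split; auto; apply in_seq; specialize (B x); lia.
  - rewrite length_seq; lia.
  - pose proof (sublist_NoDup _ _ Hs Hn) as Hn'; apply sublist_incl in Hs.
    destruct l' as [|x [|y l']]; simpl in Hl'; try lia.
    inversion Hn'; subst; simpl in *; exists x, y; repeat split; try (apply Hs; simpl; auto).
    + intros ->; tauto.
    + apply H; rewrite !Hb; auto.
Qed.

Section Types.
Context {V I : Type} (L R s : nat) (Bs : list (V -> V -> Prop)) (F : list V)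
  (W : I -> nat -> V -> Prop).

Definition upd (sg : nat -> option V) (v : nat) (o : option V) : nat -> option V :=
  fun w => if w =? v then o else sg w.

Definition atom (b : nat) : V -> V -> Prop := nth b Bs (fun _ _ => False).

(** The members of [F] act as constants. They are addressed by their position below [s], so the
    number of classes depends on [s] and not on the structure. *)
Definition same_atoms (x y : I * (nat -> option V)) : Prop :=
  (forall u, u < L -> (snd x u = None <-> snd y u = None)) /\
  (forall u, u < L -> forall t, t < S R ->
     ((exists a, snd x u = Some a /\ W (fst x) t a) <->
      (exists a, snd y u = Some a /\ W (fst y) t a))) /\
  (forall u, u < L -> forall v, v < L -> forall b, b < length Bs ->
     ((exists a a', snd x u = Some a /\ snd x v = Some a' /\ atom b a a') <->
      (exists a a', snd y u = Some a /\ snd y v = Some a' /\ atom b a a'))) /\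
  (forall u, u < L -> forall k, k < s -> forall b, b < length Bs ->
     ((exists a f, snd x u = Some a /\ nth_error F k = Some f /\ atom b a f) <->
      (exists a f, snd y u = Some a /\ nth_error F k = Some f /\ atom b a f))) /\
  (forall u, u < L -> forall k, k < s -> forall b, b < length Bs ->
     ((exists a f, snd x u = Some a /\ nth_error F k = Some f /\ atom b f a) <->
      (exists a f, snd y u = Some a /\ nth_error F k = Some f /\ atom b f a))).

(* Equality of types of quantifier rank [g]. A position consists of an index [i]
   and a partial assignment; the atomic information includes the distances to the
   [i]-th tuple, and setting a variable back to [None] counts as a move. *)
Fixpoint same_type (g : nat) (x y : I * (nat -> option V)) : Prop :=
  match g with
  | 0 => same_atoms x y
  | S g => same_atoms x y /\
      forall v, v < L ->
        (forall o, exists o', same_type g (fst x, upd (snd x) v o) (fst y, upd (snd y) v o')) /\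
        (forall o', exists o, same_type g (fst x, upd (snd x) v o) (fst y, upd (snd y) v o'))
  end.

Lemma same_type_atoms g x y : same_type g x y -> same_atoms x y.
Proof. destruct g; simpl; tauto. Qed.

Lemma same_atoms_sym x y : same_atoms x y -> same_atoms y x.
Proof.
  intros (H1 & H2 & H3 & H4 & H5).
  repeat split; intros; try (apply H1); try (apply H2); try (apply H3);
    try (apply H4); try (apply H5); auto.
Qed.

Lemma same_type_sym g : forall x y, same_type g x y -> same_type g y x.
Proof.
  induction g as [|g IH]; simpl; intros x y; [apply same_atoms_sym|].
  intros [H0 H]; split; [apply same_atoms_sym; auto|].
  intros v Hv; destruct (H v Hv) as [Ha Hb]; split.
  - intros o; destruct (Hb o) as [o' ?]; eauto.
  - intros o; destruct (Ha o) as [o' ?]; eauto.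
Qed.

End Types.

(** A type of rank [S g] is determined by the atomic information and, for each of the [L] variables,
    by the set of codes of rank [g] reachable by resetting it, one of [2 ^ N] sets. *)
Lemma same_type_finite_index (L R s nb g : nat) : exists N,
  forall (V I : Type) (Bs : list (V -> V -> Prop)) (F : list V) (W : I -> nat -> V -> Prop),
  length Bs = nb -> finite_index N (same_type L R s Bs F W g).
Proof.
  assert (H0 : exists N, forall (V I : Type) (Bs : list (V -> V -> Prop)) (F : list V)
    (W : I -> nat -> V -> Prop), length Bs = nb -> finite_index N (same_atoms L R s Bs F W)).
  { exists (2 ^ L * ((2 ^ S R) ^ L * (((2 ^ nb) ^ L) ^ L * (((2 ^ nb) ^ s) ^ L * ((2 ^ nb) ^ s) ^ L)))).
    intros V I Bs F W <-.
    apply finite_index_and; [|apply finite_index_and; [|apply finite_index_and;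
      [|apply finite_index_and]]].
    - apply finite_index_forall; intros u _; apply (finite_index_pred (fun x => snd x u = None)).
    - apply finite_index_forall; intros u _; apply finite_index_forall; intros t _.
      apply (finite_index_pred (fun x => exists a, snd x u = Some a /\ W (fst x) t a)).
    - apply finite_index_forall; intros u _; apply finite_index_forall; intros v _.
      apply finite_index_forall; intros b _.
      apply (finite_index_pred (fun x => exists a a', snd x u = Some a /\ snd x v = Some a' /\ atom Bs b a a')).
    - apply finite_index_forall; intros u _; apply finite_index_forall; intros v _.
      apply finite_index_forall; intros b _.
      apply (finite_index_pred (fun x => exists a f, snd x u = Some a /\ nth_error F v = Some f /\ atom Bs b a f)).
    - apply finite_index_forall; intros u _; apply finite_index_forall; intros v _.
      apply finite_index_forall; intros b _.
      apply (finite_index_pred (fun x => exists a f, snd x u = Some a /\ nth_error F v = Some f /\ atom Bs b f a)). }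
  destruct H0 as [N0 H0]; induction g as [|g [N IH]]; [exists N0; auto|].
  exists (N0 * (2 ^ N) ^ L); intros V I Bs F W Hnb.
  destruct (IH V I Bs F W Hnb) as (code & HB & Hc).
  destruct (finite_index_and N0 ((2 ^ N) ^ L) (same_atoms L R s Bs F W)
    (fun x y => forall v, v < L -> forall t, t < N ->
      ((exists o, code (fst x, upd (snd x) v o) = t) <->
       (exists o, code (fst y, upd (snd y) v o) = t)))) as (code' & HB' & Hc'); auto.
  { apply finite_index_forall; intros v _; apply finite_index_forall; intros t _.
    apply (finite_index_pred (fun x => exists o, code (fst x, upd (snd x) v o) = t)). }
  exists code'; split; auto; intros x y Hxy; simpl.
  destruct (Hc' x y Hxy) as [Ha Hb]; split; auto; intros v Hv; split; intros o.
  - destruct (Hb v Hv _ (HB (fst x, upd (snd x) v o))) as [H1 _].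
    destruct H1 as [o' Ho']; [eauto|]; exists o'; apply Hc; auto.
  - destruct (Hb v Hv _ (HB (fst y, upd (snd y) v o))) as [_ H1].
    destruct H1 as [o' Ho']; [eauto|]; exists o'; apply Hc; auto.
Qed.

(** * The exchange game *)

Definition gadj {Sg} (M : structure Sg) : carrier M -> carrier M -> Prop :=
  fun a b => a <> b /\ exists s l, rel M s l /\ In a l /\ In b l.

Lemma gadj_sym {Sg} (M : structure Sg) x y : gadj M x y -> gadj M y x.
Proof. intros (H & s & l & ? & ? & ?); split; eauto. Qed.

Lemma adj_gaifman {Sg} (M : structure Sg) (x y : carrier M) :
  @adj (gaifman M) x y <-> gadj M x y.
Proof.
  unfold adj; simpl; split.
  - intros (a & b & H & Hab); injection H as -> ->; exact Hab.
  - intros H; exists x, y; auto.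
Qed.

Fixpoint qrank {Sg} (phi : formula Sg) : nat :=
  match phi with
  | FRel _ _ => 0
  | FEq _ _ => 0
  | FNot p => qrank p
  | FAnd p q => Nat.max (qrank p) (qrank q)
  | FEx _ p => S (qrank p)
  end.

Fixpoint vars_below {Sg} (L : nat) (phi : formula Sg) : Prop :=
  match phi with
  | FRel _ vs => Forall (fun v => v < L) vs
  | FEq x y => x < L /\ y < L
  | FNot p => vars_below L p
  | FAnd p q => vars_below L p /\ vars_below L q
  | FEx x p => x < L /\ vars_below L p
  end.

Lemma vars_below_mono {Sg} (phi : formula Sg) L L' :
  L <= L' -> vars_below L phi -> vars_below L' phi.
Proof.
  intros HL; induction phi; simpl; try (intuition lia); auto.
  intros H; eapply Forall_impl; [|exact H]; simpl; lia.
Qed.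

Lemma vars_below_exists {Sg} (phi : formula Sg) : exists L, vars_below L phi.
Proof.
  induction phi as [s vs|x y|p [L HL]|p [L HL] q [L' HL']|x p [L HL]]; simpl.
  - induction vs as [|v vs [L HL]]; [exists 0; constructor|].
    exists (Nat.max (S v) L); constructor; [lia|].
    eapply Forall_impl; [|exact HL]; intros w Hw; cbv beta in *; lia.
  - exists (S (x + y)); lia.
  - eauto.
  - exists (Nat.max L L'); split; (eapply vars_below_mono; [|eassumption]; lia).
  - exists (Nat.max (S x) L); split; [lia|]; (eapply vars_below_mono; [|eassumption]; lia).
Qed.

(* Unary symbols are encoded as binary relations contained in the diagonal. *)
Definition atoms {Sg} (M : structure Sg) (sl : list (sym Sg)) :
    list (carrier M -> carrier M -> Prop) :=
  eq :: map (fun s x y => rel M s [x; y]) sl ++ map (fun s x y => x = y /\ rel M s [x]) sl.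

Lemma atoms_local {Sg} (M : structure Sg) sl Q x y :
  In Q (atoms M sl) -> Q x y -> x = y \/ gadj M x y.
Proof.
  intros [<-|HQ] H; auto; apply in_app_or in HQ.
  destruct HQ as [HQ|HQ]; apply in_map_iff in HQ; destruct HQ as (s & <- & _).
  - destruct (classic (x = y)); auto; right; split; auto.
    exists s, [x; y]; simpl; auto.
  - tauto.
Qed.

Section Game.
Context {Sg : signature} (M : structure Sg) (sl : list (sym Sg))
  (sl_full : forall s, In s sl) (L R s : nat) (F : list (carrier M))
  (F_len : length F <= s) (c : nat -> nat -> carrier M).

Definition near (i t : nat) (x : carrier M) : Prop :=
  exists u, u < L /\ reach (avoiding F) (gadj M) t (c i u) x.

Lemma near_mono i t t' x : t <= t' -> near i t x -> near i t' x.
Proof. intros Ht (u & Hu & H); exists u; split; auto; apply reach_mono with (3 := H); auto. Qed.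

Lemma near_step i t x y : near i t x -> gadj M x y -> ~ In y F -> near i (S t) y.
Proof. intros (u & Hu & H) Hxy Hy; exists u; split; auto; eapply reach_snoc; eauto. Qed.

Notation stype := (same_type L R s (atoms M sl) F near).

Lemma stype_near g i j sg sg' u t a b : stype g (i, sg) (j, sg') ->
  u < L -> t <= R -> sg u = Some a -> sg' u = Some b -> near i t a -> near j t b.
Proof.
  intros H Hu Ht Ha Hb Hn; apply same_type_atoms in H; destruct H as (_ & H & _).
  destruct (proj1 (H u Hu t ltac:(lia))) as (b' & Hb' & Hn'); simpl in *; [eauto|congruence].
Qed.

Lemma stype_None g x y u : stype g x y -> u < L -> snd x u = None -> snd y u = None.
Proof. intros H Hu; apply same_type_atoms in H; apply H; auto. Qed.

Lemma stype_Some g x y u a : stype g x y -> u < L -> snd x u = Some a -> exists b, snd y u = Some b.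
Proof.
  intros H Hu Ha; destruct (snd y u) as [b|] eqn:Hb; [eauto|].
  apply same_type_sym in H; apply stype_None with (u := u) in H; auto; congruence.
Qed.

Lemma In_atom Q : In Q (atoms M sl) -> exists b, b < length (atoms M sl) /\ atom (atoms M sl) b = Q.
Proof.
  intros H; destruct (In_nth _ _ (fun _ _ => False) H) as (b & Hb & HQ); exists b; auto.
Qed.

Lemma stype_binary g i j sg sg' u v a a' b b' Q : stype g (i, sg) (j, sg') ->
  u < L -> v < L -> In Q (atoms M sl) ->
  sg u = Some a -> sg v = Some b -> sg' u = Some a' -> sg' v = Some b' -> Q a b -> Q a' b'.
Proof.
  intros H Hu Hv HQ Ha Hb Ha' Hb' Hab; apply same_type_atoms in H.
  destruct H as (_ & _ & H & _); destruct (In_atom Q HQ) as (k & Hk & HkQ).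
  destruct (proj1 (H u Hu v Hv k Hk)) as (x & y & Hx & Hy & Hxy); simpl in *.
  - exists a, b; rewrite HkQ; auto.
  - rewrite HkQ in Hxy; congruence.
Qed.

Lemma stype_F_right g i j sg sg' u a a' f Q : stype g (i, sg) (j, sg') ->
  u < L -> In f F -> In Q (atoms M sl) ->
  sg u = Some a -> sg' u = Some a' -> Q a f -> Q a' f.
Proof.
  intros H Hu Hf HQ Ha Ha' Hab; apply same_type_atoms in H.
  destruct H as (_ & _ & _ & H & _); destruct (In_atom Q HQ) as (k & Hk & HkQ).
  destruct (In_nth_error _ _ Hf) as [n Hn].
  assert (Hns : n < s) by (apply Nat.lt_le_trans with (length F); auto;
    apply nth_error_Some; congruence).
  destruct (proj1 (H u Hu n Hns k Hk)) as (x & y & Hx & Hy & Hxy); simpl in *.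
  - exists a, f; rewrite HkQ; auto.
  - rewrite HkQ in Hxy; congruence.
Qed.

Lemma stype_F_left g i j sg sg' u a a' f Q : stype g (i, sg) (j, sg') ->
  u < L -> In f F -> In Q (atoms M sl) ->
  sg u = Some a -> sg' u = Some a' -> Q f a -> Q f a'.
Proof.
  intros H Hu Hf HQ Ha Ha' Hab; apply same_type_atoms in H.
  destruct H as (_ & _ & _ & _ & H); destruct (In_atom Q HQ) as (k & Hk & HkQ).
  destruct (In_nth_error _ _ Hf) as [n Hn].
  assert (Hns : n < s) by (apply Nat.lt_le_trans with (length F); auto;
    apply nth_error_Some; congruence).
  destruct (proj1 (H u Hu n Hns k Hk)) as (x & y & Hx & Hy & Hxy); simpl in *.
  - exists a, f; rewrite HkQ; auto.
  - rewrite HkQ in Hxy; congruence.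
Qed.

(** A pebble pair is recorded in at most one of two subgames: [I] compares the surroundings of [c i]
    in the first position with those of [c j] in the second, [J] the other way round. A pair
    recorded in neither stays in place. *)
Definition zone (tau g i j : nat) (x x' : carrier M) (oI oI' oJ oJ' : option (carrier M)) : Prop :=
  (x = x' /\ oI = None /\ oI' = None /\ oJ = None /\ oJ' = None /\
     (In x F \/ (~ near i (tau + 2 ^ g) x /\ ~ near j (tau + 2 ^ g) x))) \/
  (oI = Some x /\ oI' = Some x' /\ oJ = None /\ oJ' = None /\ near i tau x /\ near j tau x') \/
  (oI = None /\ oI' = None /\ oJ = Some x /\ oJ' = Some x' /\ near j tau x /\ near i tau x').

(* Winning positions for Duplicator: pebbles within distance [tau] of the tuples
   [c i], [c j] are exchanged between the two neighbourhoods, pebbles in [F] or at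
   distance more than [tau + 2 ^ g] stay where they are. *)
Definition sim (g i j : nat) (rho rho' : nat -> carrier M) : Prop :=
  exists tau sI sI' sJ sJ', tau + 2 ^ g <= R /\
    stype g (i, sI) (j, sI') /\ stype g (j, sJ) (i, sJ') /\
    forall v, v < L -> zone tau g i j (rho v) (rho' v) (sI v) (sI' v) (sJ v) (sJ' v).

Lemma sim_sym g i j rho rho' : sim g i j rho rho' -> sim g j i rho' rho.
Proof.
  intros (tau & sI & sI' & sJ & sJ' & Ht & HI & HJ & Hz).
  exists tau, sI', sI, sJ', sJ; repeat split; auto using same_type_sym.
  intros v Hv; destruct (Hz v Hv) as [H|[H|H]]; [left|right; left|right; right]; intuition congruence.
Qed.

Definition far_apart (i j : nat) : Prop :=
  forall x y, near i R x -> near j R y -> ~ (x = y \/ gadj M x y).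

Lemma far_apart_sym i j : far_apart i j -> far_apart j i.
Proof. intros H x y Hx Hy [Hxy|Hxy]; apply (H y x Hy Hx); auto using gadj_sym. Qed.

Lemma outside_in_F tau g i x y : near i tau x -> (x = y \/ gadj M x y) ->
  (In y F \/ ~ near i (tau + 2 ^ g) y) -> In y F.
Proof.
  intros Hx Hxy [Hy|Hy]; auto; apply NNPP; intros HF.
  assert (1 <= 2 ^ g) by (clear; induction g; simpl; lia).
  apply Hy; destruct Hxy as [<-|Hxy].
  - eapply near_mono; [|exact Hx]; lia.
  - apply near_mono with (S tau); [lia|]; eapply near_step; eauto.
Qed.

(** An atom relates only equal or adjacent points. Because of the gap, a pebble that stays in place
    and is related to a moved one lies in [F], and atoms with members of [F] belong to the type.
    Pebbles of different subgames are never related, by [far_apart]. *)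
Lemma sim_atom_imp g i j rho rho' u v Q : far_apart i j -> sim g i j rho rho' ->
  u < L -> v < L -> In Q (atoms M sl) -> Q (rho u) (rho v) -> Q (rho' u) (rho' v).
Proof.
  intros Hfar (tau & sI & sI' & sJ & sJ' & Ht & HI & HJ & Hz) Hu Hv HQ Huv.
  pose proof (atoms_local M sl Q _ _ HQ Huv) as Hloc.
  assert (Hloc' : rho v = rho u \/ gadj M (rho v) (rho u))
    by (destruct Hloc; auto using gadj_sym).
  assert (HtR : tau <= R) by lia.
  destruct (Hz u Hu) as [(U1 & U2 & U3 & U4 & U5 & U6)|[(U1 & U2 & U3 & U4 & U5 & U6)|(U1 & U2 & U3 & U4 & U5 & U6)]];
  destruct (Hz v Hv) as [(V1 & V2 & V3 & V4 & V5 & V6)|[(V1 & V2 & V3 & V4 & V5 & V6)|(V1 & V2 & V3 & V4 & V5 & V6)]].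
  - rewrite <- U1, <- V1; auto.
  - assert (HF : In (rho u) F) by (apply (outside_in_F tau g _ _ _ V5 Hloc'); tauto).
    rewrite <- U1; exact (stype_F_left g i j sI sI' v _ _ _ Q HI Hv HF HQ V1 V2 Huv).
  - assert (HF : In (rho u) F) by (apply (outside_in_F tau g _ _ _ V5 Hloc'); tauto).
    rewrite <- U1; exact (stype_F_left g j i sJ sJ' v _ _ _ Q HJ Hv HF HQ V3 V4 Huv).
  - assert (HF : In (rho v) F) by (apply (outside_in_F tau g _ _ _ U5 Hloc); tauto).
    rewrite <- V1; exact (stype_F_right g i j sI sI' u _ _ _ Q HI Hu HF HQ U1 U2 Huv).
  - exact (stype_binary g i j sI sI' u v _ _ _ _ Q HI Hu Hv HQ U1 V1 U2 V2 Huv).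
  - exfalso; apply (Hfar (rho u) (rho v)); auto; apply near_mono with tau; auto.
  - assert (HF : In (rho v) F) by (apply (outside_in_F tau g _ _ _ U5 Hloc); tauto).
    rewrite <- V1; exact (stype_F_right g j i sJ sJ' u _ _ _ Q HJ Hu HF HQ U3 U4 Huv).
  - exfalso; apply (Hfar (rho v) (rho u)); auto; apply near_mono with tau; auto.
  - exact (stype_binary g j i sJ sJ' u v _ _ _ _ Q HJ Hu Hv HQ U3 V3 U4 V4 Huv).
Qed.

Lemma sim_atom g i j rho rho' u v Q : far_apart i j -> sim g i j rho rho' ->
  u < L -> v < L -> In Q (atoms M sl) -> (Q (rho u) (rho v) <-> Q (rho' u) (rho' v)).
Proof.
  intros Hf Hs Hu Hv HQ; split.
  - apply sim_atom_imp with (1 := Hf) (2 := Hs); auto.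
  - apply sim_atom_imp with (1 := far_apart_sym _ _ Hf) (2 := sim_sym _ _ _ _ _ Hs); auto.
Qed.

Lemma zone_mono tau tau' g g' i j x x' oI oI' oJ oJ' :
  tau <= tau' -> tau' + 2 ^ g' <= tau + 2 ^ g ->
  zone tau g i j x x' oI oI' oJ oJ' -> zone tau' g' i j x x' oI oI' oJ oJ'.
Proof.
  intros Ht Hg [(H1 & H2 & H3 & H4 & H5 & H6)|[(H1 & H2 & H3 & H4 & H5 & H6)|(H1 & H2 & H3 & H4 & H5 & H6)]].
  - left; repeat split; auto; destruct H6 as [?|[Hi Hj]]; [auto|right].
    split; intros Hn; [apply Hi|apply Hj]; apply near_mono with (2 := Hn); auto.
  - right; left; repeat split; auto; apply near_mono with tau; auto.
  - right; right; repeat split; auto; apply near_mono with tau; auto.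
Qed.

Definition assign (rho : nat -> carrier M) (x : nat) (a : carrier M) : nat -> carrier M :=
  fun v => if Nat.eqb v x then a else rho v.

(** The gap [2 ^ S g] is cut into two halves. A pebble in the lower half or below is answered in its
    subgame and [tau] rises by [2 ^ g]; any other pebble is answered by itself and [tau] stays.
    Either way a gap of [2 ^ g] remains. *)
Lemma sim_forth g i j rho rho' x a : sim (S g) i j rho rho' -> x < L ->
  exists b, sim g i j (assign rho x a) (assign rho' x b).
Proof.
  intros (tau & sI & sI' & sJ & sJ' & Ht & [_ HI] & [_ HJ] & Hz) Hx.
  simpl in Ht.
  assert (Hg : tau + 2 ^ g <= tau + 2 ^ S g) by (simpl; lia).
  destruct (HI x Hx) as [HI1 _]; destruct (HJ x Hx) as [HJ1 _]; simpl in HI1, HJ1.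
  (* The variable [x] may have been recorded before, so a subgame that does not receive the new
     pebble has to clear it. Atomic types record where an assignment is undefined, so the answer to
     clearing is clearing. *)
  assert (HIn : stype g (i, upd sI x None) (j, upd sI' x None)).
  { destruct (HI1 None) as [o Ho].
    assert (o = None); [|subst; auto].
    pose proof (stype_None g _ _ x Ho Hx) as H; simpl in H; unfold upd in H.
    rewrite Nat.eqb_refl in H; auto. }
  assert (HJn : stype g (j, upd sJ x None) (i, upd sJ' x None)).
  { destruct (HJ1 None) as [o Ho].
    assert (o = None); [|subst; auto].
    pose proof (stype_None g _ _ x Ho Hx) as H; simpl in H; unfold upd in H.
    rewrite Nat.eqb_refl in H; auto. }
  destruct (classic (~ In a F /\ near i (tau + 2 ^ g) a)) as [[HaF Ha]|Hni];
  [|destruct (classic (~ In a F /\ near j (tau + 2 ^ g) a)) as [[HaF Ha]|Hnj]].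
  - destruct (HI1 (Some a)) as [o Ho].
    destruct (stype_Some g _ _ x a Ho Hx) as [b Hb].
    { simpl; unfold upd; rewrite Nat.eqb_refl; auto. }
    simpl in Hb; unfold upd in Hb at 1; rewrite Nat.eqb_refl in Hb; subst o.
    assert (Hnb : near j (tau + 2 ^ g) b).
    { eapply stype_near with (1 := Ho) (u := x) (a := a); eauto; try lia;
        unfold upd; rewrite Nat.eqb_refl; auto. }
    exists b, (tau + 2 ^ g), (upd sI x (Some a)), (upd sI' x (Some b)), (upd sJ x None), (upd sJ' x None).
    repeat split; auto; [lia|].
    intros v Hv; unfold upd, assign; destruct (v =? x); [right; left; auto 10|].
    apply zone_mono with (3 := Hz v Hv); simpl; lia.
  - destruct (HJ1 (Some a)) as [o Ho].
    destruct (stype_Some g _ _ x a Ho Hx) as [b Hb].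
    { simpl; unfold upd; rewrite Nat.eqb_refl; auto. }
    simpl in Hb; unfold upd in Hb at 1; rewrite Nat.eqb_refl in Hb; subst o.
    assert (Hnb : near i (tau + 2 ^ g) b).
    { eapply stype_near with (1 := Ho) (u := x) (a := a); eauto; try lia;
        unfold upd; rewrite Nat.eqb_refl; auto. }
    exists b, (tau + 2 ^ g), (upd sI x None), (upd sI' x None), (upd sJ x (Some a)), (upd sJ' x (Some b)).
    repeat split; auto; [lia|].
    intros v Hv; unfold upd, assign; destruct (v =? x); [right; right; auto 10|].
    apply zone_mono with (3 := Hz v Hv); simpl; lia.
  - exists a, tau, (upd sI x None), (upd sI' x None), (upd sJ x None), (upd sJ' x None).
    repeat split; auto; [lia|].
    intros v Hv; unfold upd, assign; destruct (v =? x).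
    + left; repeat split; auto; destruct (classic (In a F)); tauto.
    + apply zone_mono with (3 := Hz v Hv); auto.
Qed.

Lemma sim_sat (phi : formula Sg) : forall g i j rho rho', far_apart i j ->
  sim g i j rho rho' -> qrank phi <= g -> vars_below L phi ->
  (sat M rho phi <-> sat M rho' phi).
Proof.
  induction phi as [r vs|x y|p IH|p IHp q IHq|x p IH]; intros g i j rho rho' Hf Hs Hq Hv; simpl in *.
  - destruct vs as [|u [|v [|w vs]]]; simpl.
    + tauto.
    + inversion Hv; subst.
      assert (HQ : In (fun x y => x = y /\ rel M r [x]) (atoms M sl)).
      { right; apply in_or_app; right; apply in_map_iff; exists r; auto. }
      pose proof (sim_atom g i j rho rho' u u _ Hf Hs H1 H1 HQ); simpl in *; tauto.
    + inversion Hv as [|? ? Hu Hv']; inversion Hv' as [|? ? Hv1 _]; subst.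
      assert (HQ : In (fun x y => rel M r [x; y]) (atoms M sl)).
      { right; apply in_or_app; left; apply in_map_iff; exists r; auto. }
      exact (sim_atom g i j rho rho' u v _ Hf Hs Hu Hv1 HQ).
    + pose proof (arity_le2 Sg r).
      split; intros Hr; apply rel_arity in Hr; simpl in Hr; lia.
  - apply (sim_atom g i j rho rho' x y eq); simpl; tauto.
  - rewrite (IH g i j rho rho'); auto; tauto.
  - rewrite (IHp g i j rho rho'), (IHq g i j rho rho'); auto; try tauto; lia.
  - destruct g as [|g]; [lia|]; split; intros [a Ha].
    + destruct (sim_forth g i j rho rho' x a) as [b Hb]; try tauto.
      exists b; apply (IH g i j (assign rho x a) (assign rho' x b)); auto; try tauto; lia.
    + destruct (sim_forth g j i rho' rho x a) as [b Hb]; try tauto; [apply sim_sym; auto|].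
      exists b; apply (IH g j i (assign rho' x a) (assign rho x b)); auto using far_apart_sym; try tauto; lia.
Qed.
End Game.

(** * Nowhere dense classes are stable *)

Lemma lt_sig_eq m (a b : {i : nat | i < m}) : proj1_sig a = proj1_sig b -> a = b.
Proof.
  destruct a as [a Ha], b as [b Hb]; simpl; intros <-; f_equal; apply le_unique.
Qed.

Lemma adj_complete m (a b : carrier (complete m)) : adj (complete m) a b <-> a <> b.
Proof.
  unfold adj; simpl; split.
  - intros (x & y & H & Hxy); injection H as -> ->; exact Hxy.
  - intros H; exists a, b; auto.
Qed.

Lemma shallow_clique_rminor {Sg} (M : structure Sg) r t :
  0 < t -> shallow_clique (gadj M) r t -> rminor r (complete t) (gaifman M).
Proof.
  intros Ht (U & HU & HE).
  pose (uv := fun x => exists i, i < t /\ U i x).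
  pose (pick := fun x => epsilon (inhabits 0) (fun i => i < t /\ U i x)).
  assert (Hpick : forall i x, i < t -> U i x -> pick x = i).
  { intros i x Hi Hx.
    assert (Hp : pick x < t /\ U (pick x) x) by (apply epsilon_spec; eauto).
    apply NNPP; intros Hne; apply (proj1 (HE (pick x) i (proj1 Hp) Hi Hne) x); tauto. }
  (* Outside the branch sets [pick] is arbitrary; the value [0] makes [pi] total and needs [0 < t],
     while [uv] and [ue] keep such vertices out of the minor. *)
  pose (pi := fun x : carrier M => match lt_dec (pick x) t with
                     | left h => exist (fun i => i < t) (pick x) h
                     | right _ => exist (fun i => i < t) 0 Ht
                     end).
  assert (Hpi : forall i x, i < t -> U i x -> proj1_sig (pi x) = i).
  { intros i x Hi Hx; unfold pi; pose proof (Hpick i x Hi Hx).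
    destruct (lt_dec (pick x) t); simpl; auto; lia. }
  exists uv, (fun x y => gadj M x y /\ uv x /\ uv y), pi; split; [|split].
  - intros x y (H & Hx & Hy); rewrite adj_gaifman; auto 7 using gadj_sym.
  - intros [i Hi]; destruct (HU i Hi) as (c & Hc & Hr).
    exists c; split; [exists i; auto|split].
    { apply lt_sig_eq; apply Hpi; auto. }
    intros y (k & Hk & Hky) Hy.
    assert (k = i) as ->.
    { rewrite <- (Hpi k y Hk Hky), Hy; auto. }
    apply reach_edges with (E := gadj M).
    { intros x z [Hx _] [Hz _] Hxz; auto. }
    apply reach_mono with (P := U i) (n := r); auto.
    intros z Hz; split; [exists i; auto|apply lt_sig_eq, Hpi; auto].
  - intros a b; rewrite adj_complete; split.
    + intros Hab; split; auto; destruct a as [a Ha], b as [b Hb].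
      assert (Hne : a <> b).
      { intros ->; apply Hab, lt_sig_eq; auto. }
      destruct (HE a b Ha Hb Hne) as (_ & x & y & Hx & Hy & Hxy).
      exists x, y; split; [split; [auto|split; [exists a; auto|exists b; auto]]|].
      split; apply lt_sig_eq, Hpi; auto.
    + tauto.
Qed.

Lemma nowhere_dense_sparse {Sg} (C : structure Sg -> Prop) :
  nowhere_dense (underline C) -> exists bound, forall M, C M -> sparse (gadj M) bound.
Proof.
  intros H.
  exists (fun r => epsilon (inhabits 0) (fun N => forall (G : graph) (m : nat),
    underline C G -> rminor r (complete m) G -> m <= N)).
  intros M HM r t Hc.
  pose proof (epsilon_spec (inhabits 0) _ (H r)) as He; cbv beta in He.
  destruct t as [|t]; [lia|]; apply He with (gaifman M).
  - exists M; auto.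
  - apply shallow_clique_rminor; auto; lia.
Qed.

Lemma sparse_stable {Sg} (C : structure Sg -> Prop) bound :
  (forall M, C M -> sparse (gadj M) bound) -> stable C.
Proof.
  intros Hsp phi k Hop.
  destruct (sym_finite Sg) as [sl Hsl].
  destruct (vars_below_exists phi) as [L HL].
  (* The game starts with [tau = 0] and gap [2 ^ q], so this radius is what [sim] asks for. *)
  pose (q := qrank phi); pose (R := 2 ^ q).
  pose (nb := S (length sl + length sl)).
  (* Two equal or adjacent points within [R] of different tuples would join these by a walk of
     length [R + S R]. *)
  destruct (scatter_tuples bound (R + S R) L) as (s & Hsc).
  destruct (same_type_finite_index L R s nb q) as [N HN].
  (* One more than the number of classes: a type for each half of the tuple and, for each
     coordinate, the set of positions in [F] at which it occurs. *)
  destruct (Hsc (S (N * (N * (2 ^ s) ^ L)))) as [n Hn].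
  destruct (Hop n) as (M & HM & a & b & Hab).
  pose (c := fun i => join k (a i) (b i)).
  destruct (Hn nat (carrier M) (gadj M) c (seq 0 n)) as (F & l & HF & Hs & Hl & Hfar).
  { apply gadj_sym. }
  { apply Hsp; auto. }
  { apply seq_NoDup. }
  { rewrite length_seq; auto. }
  assert (Hnb : length (atoms M sl) = nb)
    by (unfold atoms; simpl; rewrite length_app, !length_map; auto).
  (* The two halves of [c i]: the [x]-variables for [true], the [y]-variables for [false].
     Coordinates in [F] are left out, since their pebbles stay in place. *)
  pose (part := fun (h : bool) i v =>
    if Bool.eqb (v <? k) h then if decb (In (c i v) F) then None else Some (c i v) else None).
  specialize (HN _ _ (atoms M sl) F (near M L F c) Hnb).
  destruct (finite_index_pair (N * (N * (2 ^ s) ^ L)) (fun i j : nat =>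
      same_type L R s (atoms M sl) F (near M L F c) q (i, part true i) (j, part true j) /\
      same_type L R s (atoms M sl) F (near M L F c) q (i, part false i) (j, part false j) /\
      forall v, v < L -> forall m, m < s ->
        (nth_error F m = Some (c i v) <-> nth_error F m = Some (c j v))) l)
    as (i & j & Hi & Hj & Hij & Ht1 & Ht2 & HcF).
  { apply finite_index_and; [|apply finite_index_and].
    - apply (finite_index_pull (fun i => (i, part true i)) N _ HN).
    - apply (finite_index_pull (fun i => (i, part false i)) N _ HN).
    - apply finite_index_forall; intros v _; apply finite_index_forall; intros m _.
      apply (finite_index_pred (fun i => nth_error F m = Some (c i v))). }
  { eapply sublist_NoDup; [exact Hs|apply seq_NoDup]. }
  { lia. }
  assert (HcF' : forall v, v < L -> In (c i v) F \/ In (c j v) F -> c i v = c j v).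
  { intros v Hv [Hin|Hin]; destruct (In_nth_error _ _ Hin) as [m Hm];
      (assert (Hms : m < s) by (apply Nat.lt_le_trans with (length F); auto;
         apply nth_error_Some; congruence));
      pose proof (HcF v Hv m Hms) as [H1 H2];
      [rewrite (H1 Hm) in Hm|rewrite (H2 Hm) in Hm]; congruence. }
  assert (Hout : forall v, v < L -> ~ In (c i v) F -> ~ In (c j v) F).
  { intros v Hv Hni Hin; apply Hni; rewrite HcF'; auto. }
  assert (Hnear : forall i v, v < L -> ~ In (c i v) F -> near M L F c i 0 (c i v)).
  { intros i' v Hv Hni; exists v; split; auto; apply reach0; auto. }
  (* The [x]-pebbles lie on [c i] and move to [c j], the [y]-pebbles move from [c j] to [c i]. The
     order property turns the two sides into [i < j] and [j < i]. *)
  assert (Hsat : sat M (join k (a i) (b j)) phi <-> sat M (join k (a j) (b i)) phi).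
  { apply (sim_sat M sl Hsl L R s F HF c phi q i j); auto.
    - intros x y (u & Hu & Hx) (v & Hv & Hy) Hxy.
      apply (Hfar i j u v); auto; apply reach_trans with x; auto.
      destruct Hxy as [->|Hxy].
      + apply reach_mono with (P := avoiding F) (n := R); auto; apply reach_sym; auto using gadj_sym.
      + apply reachS with y; auto.
        * exact (reach_end _ _ _ _ _ Hx).
        * apply reach_sym; auto using gadj_sym.
    - exists 0, (part true i), (part true j), (part false j), (part false i).
      split; [auto|split; [exact Ht1|split; [apply same_type_sym; exact Ht2|]]].
      intros v Hv; pose proof (HcF' v Hv) as Heq; pose proof (Hout v Hv) as Ho.
      pose proof (Hnear i v Hv) as Hni; pose proof (Hnear j v Hv) as Hnj.
      unfold zone, part, decb, c, join in *; destruct (v <? k); simpl.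
      + destruct (excluded_middle_informative (In (a i v) F)) as [HiF|HiF].
        * rewrite <- Heq by auto.
          destruct (excluded_middle_informative (In (a i v) F)); [|contradiction].
          left; auto 10.
        * destruct (excluded_middle_informative (In (a j v) F)); [exfalso; apply Ho; auto|].
          right; left; auto 10.
      + destruct (excluded_middle_informative (In (b i v) F)) as [HiF|HiF].
        * rewrite <- Heq by auto.
          destruct (excluded_middle_informative (In (b i v) F)); [|contradiction].
          left; auto 10.
        * destruct (excluded_middle_informative (In (b j v) F)); [exfalso; apply Ho; auto|].
          right; right; auto 10. }
  apply sublist_incl in Hs; apply Hs, in_seq in Hi; apply Hs, in_seq in Hj.
  rewrite (Hab i j), (Hab j i) in Hsat by lia; lia.
Qed.

(** * Gaifman graphs and first-order translations *)

(** The parameters for the initial segments [J = {i | i < j}] form an order pattern. *)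
Lemma stable_dependent {Sg} (K : structure Sg -> Prop) : stable K -> dependent K.
Proof.
  intros Hst phi k Hip; apply (Hst phi k); intros n.
  destruct (Hip n) as (M & HM & a & H); exists M; split; auto.
  assert (Hb : exists b : nat -> nat -> carrier M, forall j i, i < n ->
    (sat M (join k (a i) (b j)) phi <-> i < j)).
  { exists (fun j => proj1_sig (constructive_indefinite_description _ (H (fun i => i < j)))).
    intros j; apply (proj2_sig (constructive_indefinite_description _ (H (fun i => i < j)))). }
  destruct Hb as [b Hb]; exists a, b; auto.
Qed.

(** Formulas have neither disjunction nor truth: the disjunction over the symbols is a negated
    conjunction of negations, and [FEq u u] stands for truth. *)
Definition gadj_formula {Sg} (sl : list (sym Sg)) (u v : nat) : formula Sg :=
  FAnd (FNot (FEq u v))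
    (FNot (fold_right (fun s p => FAnd (FAnd (FNot (FRel s [u; v])) (FNot (FRel s [v; u]))) p)
       (FEq u u) sl)).

(** Here arity at most 2 counts: a tuple with two different entries consists of just these. So
    adjacency needs no quantifier, and each tuple contributes at most one edge. *)
Lemma gadj_binary {Sg} (M : structure Sg) x y :
  gadj M x y <-> x <> y /\ exists s, rel M s [x; y] \/ rel M s [y; x].
Proof.
  split; intros [Hne H]; split; auto.
  - destruct H as (s & l & Hr & Hx & Hy); exists s.
    pose proof (rel_arity M _ _ Hr) as Ha; pose proof (arity_le2 Sg s).
    destruct l as [|a [|b [|c l]]]; simpl in *; try lia; intuition (subst; auto; congruence).
  - destruct H as (s & [H|H]); [exists s, [x; y]|exists s, [y; x]]; simpl; auto.
Qed.

Lemma sat_gadj_formula {Sg} (M : structure Sg) sl rho u v :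
  (forall s, In s sl) -> (sat M rho (gadj_formula sl u v) <-> gadj M (rho u) (rho v)).
Proof.
  intros Hsl; rewrite gadj_binary; simpl.
  assert (H : sat M rho (fold_right (fun s p => FAnd (FAnd (FNot (FRel s [u; v])) (FNot (FRel s [v; u]))) p)
       (FEq u u) sl) <-> forall s, In s sl -> ~ (rel M s [rho u; rho v] \/ rel M s [rho v; rho u])).
  { clear Hsl; induction sl as [|s sl IH]; simpl; [intuition|].
    rewrite IH; split.
    - intros [[H1 H2] H3] r [<-|Hr]; [tauto|auto].
    - intros H; repeat split; auto; intros Hr; apply (H s); auto. }
  rewrite H; split; intros [Hne Hn]; split; auto.
  - apply NNPP; intros Hex; apply Hn; intros s _ Hs; eauto.
  - destruct Hn as [s Hs]; intros Hall; apply (Hall s); auto.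
Qed.

Fixpoint translate {Sg} (sl : list (sym Sg)) (phi : formula graph_sig) : formula Sg :=
  match phi with
  | FRel _ [u; v] => gadj_formula sl u v
  | FRel _ _ => FNot (FEq 0 0)
  | FEq x y => FEq x y
  | FNot p => FNot (translate sl p)
  | FAnd p q => FAnd (translate sl p) (translate sl q)
  | FEx x p => FEx x (translate sl p)
  end.

Lemma sat_translate {Sg} (M : structure Sg) sl phi : (forall s, In s sl) ->
  forall rho : nat -> carrier M, sat M rho (translate sl phi) <-> sat (gaifman M) rho phi.
Proof.
  intros Hsl; induction phi as [[] vs|x y|p IH|p IHp q IHq|x p IH]; intros rho.
  - destruct vs as [|u [|v [|w vs]]]; try (simpl; split; [intros []; auto|
      intros (a & b & H & _); discriminate]).
    + simpl translate; rewrite sat_gadj_formula by auto.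
      rewrite <- adj_gaifman; reflexivity.
  - reflexivity.
  - simpl; rewrite IH; reflexivity.
  - simpl; rewrite IHp, IHq; reflexivity.
  - simpl; split; intros [a Ha]; exists a; apply IH; auto.
Qed.

Lemma stable_underline {Sg} (C : structure Sg -> Prop) : stable C -> stable (underline C).
Proof.
  destruct (sym_finite Sg) as [sl Hsl]; intros Hst phi k Hop.
  apply (Hst (translate sl phi) k); intros n.
  destruct (Hop n) as (G & (M & HM & ->) & a & b & H); exists M; split; auto.
  exists a, b; intros i j Hi Hj; rewrite sat_translate by auto; auto.
Qed.

Lemma dependent_underline {Sg} (C : structure Sg -> Prop) : dependent C -> dependent (underline C).
Proof.
  destruct (sym_finite Sg) as [sl Hsl]; intros Hst phi k Hop.
  apply (Hst (translate sl phi) k); intros n.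
  destruct (Hop n) as (G & (M & HM & ->) & a & H); exists M; split; auto.
  exists a; intros J; destruct (H J) as [b Hb]; exists b.
  intros i Hi; rewrite sat_translate by auto; auto.
Qed.

(** * Independence in subdivided cliques *)

Fixpoint walk {V : Type} (E : V -> V -> Prop) (t : nat) (x y : V) : Prop :=
  match t with
  | 0 => x = y
  | S t => exists z, E x z /\ walk E t z y
  end.

(** The bound variables [2 + t] descend, so the variable of the current vertex is never captured;
    the end of the walk is always variable [1]. *)
Fixpoint walk_formula (t u : nat) : formula graph_sig :=
  match t with
  | 0 => FEq u 1
  | S t => FEx (2 + t) (FAnd (FRel (tt : sym graph_sig) [u; 2 + t]) (walk_formula t (2 + t)))
  end.

Lemma sat_walk_formula (G : graph) t : forall u rho, u < 2 \/ 2 + t <= u ->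
  (sat G rho (walk_formula t u) <-> walk (@adj G) t (rho u) (rho 1)).
Proof.
  induction t as [|t IH]; intros u rho Hu; [reflexivity|].
  assert (Hut : (u =? 2 + t) = false) by (apply Nat.eqb_neq; lia).
  cbn [walk_formula sat walk].
  assert (H : forall a, let rho' := (fun v => if v =? 2 + t then a else rho v) in
     rel G (tt : sym graph_sig) (map rho' [u; 2 + t]) /\ sat G rho' (walk_formula t (2 + t)) <->
     adj G (rho u) a /\ walk (@adj G) t a (rho 1)).
  { intros a rho'; rewrite IH by lia; unfold adj, rho'; cbn [map].
    rewrite Hut, Nat.eqb_refl; reflexivity. }
  split; intros [a Ha]; exists a; apply H; auto.
Qed.

(** With [N = 2 ^ n], [e x i] reads the binary digit of [x] in place [i]: each step doubles [N], and
    the upper half has the new digit. *)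
Lemma subset_codes (n : nat) : exists N (e : nat -> nat -> Prop), 0 < N /\
  forall J : nat -> Prop, exists x, x < N /\ forall i, i < n -> (e x i <-> J i).
Proof.
  induction n as [|n (N & e & HN & H)].
  { exists 1, (fun _ _ => True); split; [lia|]; intros J; exists 0; split; intros; lia. }
  exists (N + N), (fun x i => if i =? n then N <= x else e (if x <? N then x else x - N) i).
  split; [lia|]; intros J; destruct (H J) as (x & Hx & Hxi).
  destruct (classic (J n)) as [Hn|Hn].
  - exists (x + N); split; [lia|]; intros i Hi.
    destruct (Nat.eqb_spec i n) as [->|Hne]; [split; auto; lia|].
    destruct (Nat.ltb_spec (x + N) N); [lia|].
    replace (x + N - N) with x by lia; apply Hxi; lia.
  - exists x; split; [lia|]; intros i Hi.
    destruct (Nat.eqb_spec i n) as [->|Hne]; [split; [lia|tauto]|].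
    destruct (Nat.ltb_spec x N); [apply Hxi; lia|lia].
Qed.

Section Subdivision.
Context (r m : nat) (good : nat -> nat -> Prop).

(* The pair of branch vertices whose subdivided edge contains the edge [x y]. *)
Definition edge_pair (x y : subdiv_vertex r m) : nat * nat :=
  match x, y with
  | inl i, inl j => (proj1_sig i, proj1_sig j)
  | inr p, _ => fst (proj1_sig p)
  | inl _, inr p => fst (proj1_sig p)
  end.

Definition kept (x y : subdiv_vertex r m) : Prop :=
  (subdiv_base x y /\ good (fst (edge_pair x y)) (snd (edge_pair x y))) \/
  (subdiv_base y x /\ good (fst (edge_pair y x)) (snd (edge_pair y x))).

Context (n : nat) (good_spec : forall i j, good i j -> i < n /\ n <= j).

(** With [r] subdivision vertices on each edge, a walk from the branch vertex [i] cannot leave its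
    star in [r] steps; so a walk of length [S r] that ends in a branch vertex of the other side has
    run along a single edge. *)
Definition in_ball (i s : nat) (x : subdiv_vertex r m) : Prop :=
  match x with
  | inl k => proj1_sig k = i
  | inr p => fst (fst (proj1_sig p)) = i /\ S (snd (proj1_sig p)) <= s /\
             good (fst (fst (proj1_sig p))) (snd (fst (proj1_sig p)))
  end.

Lemma in_ball_step i s x y : i < n -> s < r -> in_ball i s x -> kept x y -> in_ball i (S s) y.
Proof.
  intros Hi Hs Hx Hxy.
  destruct x as [[a Ha]|[[[a b] k] Hp]], y as [[a' Ha']|[[[a' b'] k'] Hp']];
    unfold kept in Hxy; simpl in *;
    destruct Hxy as [[Hb Hg]|[Hb Hg]]; pose proof (good_spec _ _ Hg);
    try (destruct Hb as [Hb Hb']; try injection Hb as ? ?; subst; simpl in *; intuition (subst; auto; try lia)).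
Qed.

Lemma in_ball_last i x (j : {j : nat | j < m}) : i < n -> n <= proj1_sig j ->
  in_ball i r x -> kept x (inl j) -> good i (proj1_sig j).
Proof.
  intros Hi Hj Hx Hxy; destruct j as [j Hjm].
  destruct x as [[a Ha]|[[[a b] k] Hp]]; unfold kept in Hxy; simpl in *;
    destruct Hxy as [[Hb Hg]|[Hb Hg]]; pose proof (good_spec _ _ Hg);
    destruct Hb as [Hb Hb']; subst; try lia; auto.
  - destruct Hx as (<- & _); auto.
Qed.

End Subdivision.

Section Independence.
Context {Sg : signature} (C : structure Sg -> Prop) (HC : monotone C) (M : structure Sg) (HM : C M)
  (r m : nat) (f : subdiv_vertex r m -> carrier M)
  (f_inj : forall x y, f x = f y -> x = y)
  (f_adj : forall x y, subdiv_base x y -> gadj M (f x) (f y))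
  (good : nat -> nat -> Prop) (n : nat) (good_spec : forall i j, good i j -> i < n /\ n <= j).

(** All tuples are removed from all relations except pairs along kept edges. The identity is an
    injective homomorphism into [M], so monotonicity applies although the substructure is not
    induced. *)
Definition kept_structure : structure Sg.
Proof.
  refine {| carrier := carrier M;
            rel := fun s l => rel M s l /\ exists x y, kept r m good x y /\ l = [f x; f y] |}.
  intros s l [H _]; exact (rel_arity M s l H).
Defined.

Lemma kept_structure_in : C kept_structure.
Proof.
  refine (HC kept_structure M (fun x => x) _ HM); split; auto.
  intros s l [H _]; rewrite map_id; auto.
Qed.

Lemma gadj_kept a b : gadj kept_structure a b <-> exists x y, kept r m good x y /\ a = f x /\ b = f y.
Proof.
  assert (Hsym : forall x y, kept r m good x y -> kept r m good y x) by (unfold kept; tauto).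
  rewrite gadj_binary; simpl; split.
  - intros (_ & s & [(_ & x & y & Hk & H)|(_ & x & y & Hk & H)]); injection H as -> ->; eauto.
    exists y, x; auto.
  - intros (x & y & Hk & -> & ->).
    assert (H : gadj M (f x) (f y)).
    { destruct Hk as [[Hb _]|[Hb _]]; auto using gadj_sym. }
    apply gadj_binary in H; destruct H as (Hne & s & Hs); split; auto; exists s.
    destruct Hs; [left|right]; split; eauto.
Qed.

Lemma kept_walk_good i (j : {j : nat | j < m}) : i < n -> n <= proj1_sig j ->
  forall t s x, s + S t = S r -> in_ball r m good i s x ->
  walk (gadj kept_structure) (S t) (f x) (f (inl j)) -> good i (proj1_sig j).
Proof.
  intros Hi Hj; induction t as [|t IH]; intros s x Hs Hx (z & Hz & Hw);
    apply gadj_kept in Hz; destruct Hz as (x' & y & Hk & Hx' & ->); apply f_inj in Hx'; subst x'.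
  - simpl in Hw; apply f_inj in Hw; subst y.
    replace s with r in Hx by lia; eapply in_ball_last; eauto.
  - apply (IH (S s) y); [lia| |exact Hw].
    eapply in_ball_step; eauto; lia.
Qed.

Lemma good_kept_walk (i j : {j : nat | j < m}) : proj1_sig i < proj1_sig j ->
  good (proj1_sig i) (proj1_sig j) ->
  walk (gadj kept_structure) (S r) (f (inl i)) (f (inl j)).
Proof.
  intros Hij Hg; destruct i as [i Hi], j as [j Hj]; simpl in *.
  pose (mid := fun k (Hk : k < r) => @inr {i | i < m} {p : nat * nat * nat | fst (fst p) < snd (fst p) < m /\ snd p < r}
    (exist _ (i, j, k) (conj (conj Hij Hj) Hk)) : subdiv_vertex r m).
  assert (Hmid : forall d k (Hk : k < r), k + S d = r ->
    walk (gadj kept_structure) (S d) (f (mid k Hk)) (f (inl (exist _ j Hj)))).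
  { induction d as [|d IH]; intros k Hk Hd.
    - exists (f (inl (exist _ j Hj))); split; [|reflexivity].
      apply gadj_kept; eexists; eexists; split; [|split; reflexivity].
      left; simpl; repeat split; auto; lia.
    - assert (Hk' : S k < r) by lia.
      exists (f (mid (S k) Hk')); split; [|apply IH; lia].
      apply gadj_kept; eexists; eexists; split; [|split; reflexivity].
      left; simpl; repeat split; auto. }
  destruct (Nat.eq_dec r 0) as [Hr|Hr].
  - assert (H0 : forall t (x : carrier M), t = 0 -> walk (gadj kept_structure) t x x)
      by (intros t x ->; reflexivity).
    exists (f (inl (exist _ j Hj))); split; [|apply H0; auto].
    apply gadj_kept; eexists; eexists; split; [|split; reflexivity].
    left; simpl; auto.
  - assert (H0 : 0 < r) by lia.
    exists (f (mid 0 H0)); split.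
    + apply gadj_kept; eexists; eexists; split; [|split; reflexivity].
      left; simpl; auto.
    + assert (Hw : forall d, S d = r -> walk (gadj kept_structure) (S d) (f (mid 0 H0))
        (f (inl (exist _ j Hj)))) by (intros d Hd; apply Hmid; lia).
      specialize (Hw (pred r)); replace (S (pred r)) with r in Hw by lia; auto.
Qed.
End Independence.

Lemma walk_iff {V} (E E' : V -> V -> Prop) t : (forall x y, E x y <-> E' x y) ->
  forall x y, walk E t x y <-> walk E' t x y.
Proof.
  intros H; induction t as [|t IH]; intros x y; simpl; [reflexivity|].
  split; intros (z & Hz & Hw); exists z; split; try apply H; try apply IH; auto.
Qed.

Lemma dependent_superflat {Sg} (C : structure Sg -> Prop) : monotone C ->
  dependent (underline C) -> superflat (underline C).
Proof.
  intros HC Hd r; apply NNPP; intros Hno.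
  apply (Hd (walk_formula (S r) 0) 1); intros n.
  destruct (subset_codes n) as (N & e & HN & He).
  (* Branch vertices below [n] stand for the elements, the branch vertex [n + x] for the subset
     coded by [x]; the edges to keep are those of the membership relation. *)
  pose (good := fun i j => i < n /\ n <= j /\ e (j - n) i).
  assert (Hm : exists M, C M /\ exists f, inj_hom (subdivided_clique r (n + N)) (gaifman M) f).
  { apply NNPP; intros Hn; apply Hno; exists (n + N); intros G (M & HM & ->) Hf; apply Hn; eauto. }
  destruct Hm as (M & HM & f & f_inj & f_hom).
  assert (f_adj : forall x y : subdiv_vertex r (n + N), subdiv_base x y -> gadj M (f x) (f y)).
  { intros x y Hxy; apply adj_gaifman; apply (f_hom tt [x; y]); exists x, y; auto. }
  pose (K := kept_structure M r (n + N) f good).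
  exists (gaifman K); split.
  { exists K; split; auto; apply kept_structure_in; auto. }
  assert (Hbr : exists br : nat -> {j : nat | j < n + N}, forall k, k < n + N -> proj1_sig (br k) = k).
  { assert (H0 : 0 < n + N) by lia.
    exists (fun k => match lt_dec k (n + N) with
                     | left h => exist (fun j => j < n + N) k h
                     | right _ => exist (fun j => j < n + N) 0 H0
                     end).
    intros k Hk; destruct (lt_dec k (n + N)); [reflexivity|contradiction]. }
  destruct Hbr as [br Hbr].
  exists (fun i _ => f (inl (br i))); intros J; destruct (He J) as (x & Hx & HJ).
  exists (fun _ => f (inl (br (n + x)))); intros i Hi.
  rewrite sat_walk_formula by lia.
  rewrite (walk_iff _ (gadj K)) by (intros; apply adj_gaifman).
  assert (Hgs : forall a b, good a b -> a < n /\ n <= b) by (unfold good; tauto).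
  assert (Hg : good i (n + x) <-> J i).
  { unfold good; replace (n + x - n) with x by lia; rewrite (HJ i Hi); intuition lia. }
  pose proof (Hbr i ltac:(lia)) as Hbi; pose proof (Hbr (n + x) ltac:(lia)) as Hbx.
  change (walk (gadj K) (S r) (f (inl (br i))) (f (inl (br (n + x)))) <-> J i).
  rewrite <- Hg; split.
  - intros Hw; rewrite <- Hbx.
    apply (kept_walk_good M r (n + N) f f_inj f_adj good n Hgs i (br (n + x)) Hi) with (t := r) (s := 0) (x := inl (br i));
      auto; lia.
  - intros Hgood; apply good_kept_walk; auto; rewrite Hbi, Hbx; auto; lia.
Qed.

(** * Subdivided cliques from shallow clique minors *)

(** A walk is stored as its start [x] and the list [p] of further vertices, so its end is
    [last p x], also when [p] is empty. *)
Fixpoint chain {V : Type} (E : V -> V -> Prop) (x : V) (p : list V) : Prop :=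
  match p with
  | [] => True
  | y :: p => E x y /\ chain E y p
  end.

Lemma last_cons {V} (x d : V) (p : list V) : last (x :: p) d = last p x.
Proof.
  revert x d; induction p as [|y p IH]; intros x d; [reflexivity|].
  change (last (y :: p) d = last (y :: p) x); rewrite !IH; reflexivity.
Qed.

Lemma last_app_default {V} (p q : list V) d : last (p ++ q) d = last q (last p d).
Proof.
  revert d; induction p as [|x p IH]; intros d; [reflexivity|].
  rewrite <- app_comm_cons, !last_cons; auto.
Qed.

Lemma chain_app {V} (E : V -> V -> Prop) p q x :
  chain E x (p ++ q) <-> chain E x p /\ chain E (last p x) q.
Proof.
  revert x; induction p as [|y p IH]; intros x; [simpl; tauto|].
  rewrite last_cons; simpl; rewrite IH; tauto.
Qed.

Lemma chain_rev {V} (E : V -> V -> Prop) (Es : forall x y, E x y -> E y x) p :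
  forall u v, E v (last p u) -> chain E u p -> chain E v (rev p ++ [u]).
Proof.
  induction p as [|y p IH]; intros u v Hv Hp; [simpl in *; auto|].
  rewrite last_cons in Hv; destruct Hp as [Huy Hp]; simpl.
  apply chain_app; split; [apply IH; auto|].
  rewrite last_app_default; simpl; auto.
Qed.

Lemma chain_nth {V} (E : V -> V -> Prop) d p : forall x k, chain E x p -> S k < length p ->
  E (nth k p d) (nth (S k) p d).
Proof.
  induction p as [|y p IH]; intros x k Hc Hk; simpl in Hk; [lia|].
  destruct Hc as [_ Hc]; destruct k as [|k].
  - destruct p as [|z p]; [simpl in Hk; lia|]; apply Hc.
  - apply (IH y k); auto; lia.
Qed.

Lemma simple_path {V} (P : V -> Prop) (E : V -> V -> Prop) n x y : reach P E n x y ->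
  exists p, length p <= n /\ chain E x p /\ last p x = y /\ NoDup (x :: p) /\
    forall z, In z (x :: p) -> P z.
Proof.
  induction 1 as [n x Hx|n x y z Hx Hxy H (p & Hl & Hc & Hlast & Hnd & HP)].
  { exists []; simpl; repeat split; auto; [lia|constructor; auto; constructor|].
    intros z [<-|[]]; auto. }
  destruct (classic (In x (y :: p))) as [Hin|Hin].
  (* The path from [y] returns to [x]: keeping only [l2], the part after [x], cuts off the loop. *)
  - destruct (in_split _ _ Hin) as (l1 & l2 & Heq).
    assert (Hl2 : length l2 <= length p).
    { apply (f_equal (@length V)) in Heq; rewrite length_app in Heq; simpl in Heq; lia. }
    exists l2; repeat split.
    + lia.
    + destruct l1 as [|y' l1]; simpl in Heq; injection Heq as <- Hp; subst p; auto.
      apply chain_app in Hc; apply Hc.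
    + rewrite <- Hlast, <- (last_cons y y), Heq, last_app_default, last_cons; auto.
    + rewrite Heq in Hnd; apply NoDup_app_remove_l in Hnd; auto.
    + intros w Hw; apply HP; rewrite Heq; apply in_or_app; auto.
  - exists (y :: p); repeat split; simpl length; auto; [lia|rewrite last_cons; auto|constructor; auto|].
    intros w [<-|Hw]; auto.
Qed.

Lemma last_occurrence {V} (D : V -> Prop) (q : list V) : (exists z, In z q /\ D z) ->
  exists pre u post, q = pre ++ u :: post /\ D u /\ forall z, In z post -> ~ D z.
Proof.
  induction q as [|x q IH]; intros (z & Hz & HD); [destruct Hz|].
  destruct (classic (exists z, In z q /\ D z)) as [Hex|Hno].
  - destruct (IH Hex) as (pre & u & post & -> & Hu & Hpost).
    exists (x :: pre), u, post; auto.
  - exists [], x, q; repeat split; auto.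
    + destruct Hz as [->|Hz]; auto; exfalso; eauto.
    + intros w Hw HDw; eauto.
Qed.

Lemma list_choice {A B} (Q : A -> list B -> Prop) (l : list A) :
  (forall j, In j l -> exists p, Q j p) -> exists p, forall j, In j l -> Q j (p j).
Proof.
  intros H; exists (fun j => epsilon (inhabits []) (Q j)); intros j Hj.
  apply epsilon_spec; auto.
Qed.

(* [leg j] lists the vertices after [u] on the path from [u] to [x j]; it is empty if [x j = u]. *)
Definition is_fan {A V : Type} (E : V -> V -> Prop) (U : V -> Prop) (r : nat)
    (u : V) (leg : A -> list V) (x : A -> V) (l : list A) : Prop :=
  U u /\
  (forall j, In j l -> length (leg j) <= r /\ chain E u (leg j) /\ last (leg j) u = x j /\
     NoDup (u :: leg j) /\ forall z, In z (leg j) -> U z) /\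
  (forall i j, In i l -> In j l -> i <> j -> forall z, In z (leg i) -> In z (leg j) -> False).

Lemma is_fan_incl {A V} (E : V -> V -> Prop) (U : V -> Prop) r u (leg : A -> list V) x l l' :
  incl l' l -> is_fan E U r u leg x l -> is_fan E U r u leg x l'.
Proof.
  intros Hi (H1 & H2 & H3); repeat split; auto; try (apply H2; auto).
  intros; eapply H3 with (i := i) (j := j); eauto.
Qed.

(** Each path is cut after its last vertex in [c :: core]. What follows avoids the core, so these
    legs are disjoint. The vertex at the cut has at most [S (S r)] possible values, and a frequent
    one becomes the hub. *)
Lemma fan_exists (r t : nat) : exists n,
  forall (A V : Type) (E : V -> V -> Prop) (U : V -> Prop) (c : V) (x : A -> V) (l : list A),
  n <= length l -> (forall j, In j l -> reach U E r c (x j)) ->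
  exists u leg l', sublist l' l /\ t <= length l' /\ is_fan E U r u leg x l'.
Proof.
  destruct (sunflower (S r) (S (S (S r) * t))) as [n Hn]; exists n.
  intros A V E U c x l Hl Hr.
  destruct (list_choice (fun j p => length p <= r /\ chain E c p /\ last p c = x j /\
    NoDup (c :: p) /\ forall z, In z (c :: p) -> U z) l) as [p Hp].
  { intros j Hj; apply simple_path; auto. }
  destruct (Hn A V (fun j => c :: p j) l Hl) as (core & l1 & Hcore & Hs1 & Hl1 & Hsun).
  { intros j Hj; simpl; apply le_n_S, Hp; auto. }
  assert (Hi1 := sublist_incl _ _ Hs1).
  destruct (pigeonhole (fun j u => exists pre leg, c :: p j = pre ++ u :: leg /\
    forall z, In z leg -> ~ In z (c :: core)) t (c :: core) l1) as (u & l2 & Hu & Hs2 & Hl2 & H2).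
  { intros j Hj.
    destruct (last_occurrence (fun z => In z (c :: core)) (c :: p j)) as (pre & u & leg & H & Hu & Hleg);
      [exists c; simpl; auto|].
    exists u; split; auto; exists pre, leg; auto. }
  { simpl length; nia. }
  destruct (list_choice (fun j leg => exists pre, c :: p j = pre ++ u :: leg /\
    forall z, In z leg -> ~ In z (c :: core)) l2) as [leg Hleg].
  { intros j Hj; destruct (H2 j Hj) as (pre & leg & ?); eauto. }
  assert (Hi2 := sublist_incl _ _ Hs2).
  exists u, leg, l2; split; [eapply sublist_trans; eauto|split; [lia|]].
  assert (Hspec : forall j, In j l2 -> length (leg j) <= r /\ chain E u (leg j) /\ last (leg j) u = x j /\
     NoDup (u :: leg j) /\ forall z, In z (u :: leg j) -> U z).
  { intros j Hj; destruct (Hleg j Hj) as (pre & Heq & _).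
    destruct (Hp j (Hi1 _ (Hi2 _ Hj))) as (P1 & P2 & P3 & P4 & P5).
    assert (Hlen : length (leg j) <= length (p j)).
    { apply (f_equal (@length V)) in Heq; rewrite length_app in Heq; simpl in Heq; lia. }
    repeat split.
    - lia.
    - destruct pre as [|c' pre]; simpl in Heq; injection Heq as <- Hpj; rewrite Hpj in *; auto.
      apply chain_app in P2; apply P2.
    - rewrite <- P3, <- (last_cons c c), Heq, last_app_default, last_cons; auto.
    - rewrite Heq in P4; apply NoDup_app_remove_l in P4; auto.
    - intros z Hz; apply P5; rewrite Heq; apply in_or_app; auto. }
  repeat split.
  - destruct l2 as [|j l2]; [simpl in Hl2; lia|].
    apply (Hspec j); simpl; auto.
  - apply Hspec; auto.
  - apply Hspec; auto.
  - apply Hspec; auto.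
  - apply Hspec; auto.
  - intros z Hz; apply (Hspec j H); simpl; auto.
  - intros i j Hi Hj Hij z Hzi Hzj.
    destruct (Hleg i Hi) as (pre & Heq & Hni); destruct (Hleg j Hj) as (pre' & Heq' & _).
    apply (Hni z Hzi); right.
    apply (Hsun i j); auto; [rewrite Heq|rewrite Heq']; apply in_or_app; simpl; auto.
Qed.

(** [B] is a reservoir of connecting branch sets. The family shrinks to the fan of each new hub
    before the next hub is sought, so every fan keeps a leg for each member of [B]. *)
Lemma hubs_exist (r m k : nat) : exists n,
  forall (V : Type) (E : V -> V -> Prop) (U : nat -> V -> Prop) (att : nat -> nat -> V) (l : list nat),
  NoDup l -> n <= length l ->
  (forall i, In i l -> exists c, U i c /\ forall y, U i y -> reach (U i) E r c y) ->
  (forall i j, In i l -> In j l -> i <> j -> U i (att i j)) ->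
  exists (A B : list nat) (hub : nat -> V) (leg : nat -> nat -> list V),
    NoDup (A ++ B) /\ incl (A ++ B) l /\ length A = m /\ k <= length B /\
    forall a, In a A -> is_fan E (U a) r (hub a) (leg a) (att a) B.
Proof.
  induction m as [|m [n IH]].
  { exists k; intros V E U att l Hnd Hl _ _.
    exists [], l, (fun i => att i i), (fun _ _ => []); repeat split; auto using incl_refl; destruct H. }
  destruct (fan_exists r n) as [n1 Hn1]; exists (S n1).
  intros V E U att [|i l] Hnd Hl Hc Hatt; simpl in Hl; [lia|].
  inversion Hnd as [|? ? Hil Hnd']; subst.
  destruct (Hc i (or_introl eq_refl)) as (c & _ & Hci).
  destruct (Hn1 nat V E (U i) c (att i) l) as (u & lg & l2 & Hs2 & Hl2 & Hfan); [lia| |].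
  { intros j Hj; apply Hci, Hatt; simpl; auto; intros ->; auto. }
  assert (Hi2 := sublist_incl _ _ Hs2).
  destruct (IH V E U att l2) as (A & B & hub & leg & HAB & Hinc & HA & HB & H); auto.
  { eapply sublist_NoDup; eauto. }
  { intros j Hj; apply Hc; simpl; auto. }
  { intros j j' Hj Hj'; apply Hatt; simpl; auto. }
  exists (i :: A), B, (fun a => if a =? i then u else hub a), (fun a => if a =? i then lg else leg a).
  assert (HiAB : ~ In i (A ++ B)) by (intros Hin; apply Hil, Hi2, Hinc; auto).
  simpl; split; [|split; [|split; [|split]]]; auto.
  - constructor; auto.
  - intros j [<-|Hj]; simpl; auto.
  - intros a Ha; destruct (Nat.eqb_spec a i) as [->|Hne].
    + eapply is_fan_incl; [|exact Hfan]; intros b Hb; apply Hinc, in_or_app; auto.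
    + apply H; destruct Ha as [->|Ha]; [congruence|auto].
Qed.

(** The chosen edges [ed i j] are read only for [i < j], so [att i j] and [att j i] are the ends of
    the same edge. *)
Lemma shallow_clique_attach {V} (E : V -> V -> Prop) r t : (forall x y, E x y -> E y x) ->
  0 < t -> shallow_clique E r t -> exists (U : nat -> V -> Prop) (att : nat -> nat -> V),
    (forall i, i < t -> exists c, U i c /\ forall y, U i y -> reach (U i) E r c y) /\
    (forall i j x, i < t -> j < t -> U i x -> U j x -> i = j) /\
    (forall i j, i < t -> j < t -> i <> j -> U i (att i j) /\ E (att i j) (att j i)).
Proof.
  intros Es Ht (U & HU & HE); destruct (HU 0 Ht) as (c0 & _ & _).
  pose (ed := fun i j => epsilon (inhabits (c0, c0)) (fun e => U i (fst e) /\ U j (snd e) /\ E (fst e) (snd e))).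
  assert (Hed : forall i j, i < t -> j < t -> i <> j ->
    U i (fst (ed i j)) /\ U j (snd (ed i j)) /\ E (fst (ed i j)) (snd (ed i j))).
  { intros i j Hi Hj Hij; apply (epsilon_spec (inhabits (c0, c0))
      (fun e => U i (fst e) /\ U j (snd e) /\ E (fst e) (snd e))).
    destruct (HE i j Hi Hj Hij) as (_ & x & y & H); exists (x, y); auto. }
  exists U, (fun i j => if i <? j then fst (ed i j) else snd (ed j i)); split; [auto|split].
  - intros i j x Hi Hj Hx Hx'; apply NNPP; intros Hij; apply (proj1 (HE i j Hi Hj Hij) x); auto.
  - intros i j Hi Hj Hij; destruct (Hed i j) as (? & ? & ?); auto; destruct (Hed j i) as (? & ? & ?); auto.
    destruct (Nat.ltb_spec i j), (Nat.ltb_spec j i); try lia; auto.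
Qed.

(* [u i] are the branch vertices and [q i j] the subdivision vertices of the edge [i j]. *)
Definition is_subdivision {V : Type} (E : V -> V -> Prop) (r m : nat)
    (u : nat -> V) (q : nat -> nat -> list V) : Prop :=
  (forall i j, i < m -> j < m -> u i = u j -> i = j) /\
  (forall i j, i < j < m -> length (q i j) = r /\ NoDup (q i j) /\ chain E (u i) (q i j ++ [u j]) /\
     forall s, s < m -> ~ In (u s) (q i j)) /\
  (forall i j i' j' z, i < j < m -> i' < j' < m -> In z (q i j) -> In z (q i' j') -> i = i' /\ j = j').

(** A path between two hubs has two legs of at most [r] vertices each and at most [2 * r + 1]
    vertices in the connecting branch set, hence fewer than [4 * r + 2] inner vertices. *)
Lemma shallow_clique_subdivision (r m : nat) : exists t,
  forall (V : Type) (E : V -> V -> Prop), (forall x y, E x y -> E y x) -> shallow_clique E r t ->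
  exists c u q, c < 4 * r + 2 /\ is_subdivision E c m u q.
Proof.
  destruct (ramsey_colours (4 * r + 2) m) as [n Hram].
  destruct (hubs_exist r n (n * n)) as [t Hhub].
  exists (S t); intros V E Es Hsc.
  destruct (shallow_clique_attach E r (S t) Es ltac:(lia) Hsc) as (U & att & HU & Hdis & Hatt).
  assert (Hseq : forall i, In i (seq 0 (S t)) -> i < S t) by (intros i Hi; apply in_seq in Hi; lia).
  destruct (Hhub V E U att (seq 0 (S t))) as (A & B & hub & leg & HAB & Hinc & HA & HB & Hfan).
  { apply seq_NoDup. }
  { rewrite length_seq; lia. }
  { intros i Hi; apply HU, Hseq; auto. }
  { intros i j Hi Hj Hij; apply Hatt; auto. }
  assert (HtA : forall a, In a A -> a < S t) by (intros a Ha; apply Hseq, Hinc, in_or_app; auto).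
  assert (HtB : forall b, In b B -> b < S t) by (intros b Hb; apply Hseq, Hinc, in_or_app; auto).
  assert (HABd : forall a, In a A -> In a B -> False).
  { intros a Ha Hb; destruct (in_split _ _ Ha) as (A1 & A2 & ->).
    rewrite <- app_assoc in HAB; apply NoDup_app_remove_l in HAB; simpl in HAB.
    inversion HAB; subst; apply H1, in_or_app; auto. }
  (* Every pair of hubs gets a connecting branch set of its own, whence the [n * n] members of
     [B]. *)
  pose (a := fun p => nth p A 0); pose (k := fun p q => nth (p * n + q) B 0).
  assert (Ha : forall p, p < n -> In (a p) A) by (intros p Hp; apply nth_In; lia).
  assert (Hk : forall p q, p < n -> q < n -> In (k p q) B) by (intros p q Hp Hq; apply nth_In; nia).
  assert (Hainj : forall p q, p < n -> q < n -> a p = a q -> p = q).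
  { intros p q Hp Hq Heq; apply (NoDup_nth A 0); try lia; auto.
    apply NoDup_app_remove_r in HAB; auto. }
  assert (Hkinj : forall p q p' q', p < n -> q < n -> p' < n -> q' < n ->
    k p q = k p' q' -> p = p' /\ q = q').
  { intros p q p' q' Hp Hq Hp' Hq' Heq.
    assert (p * n + q = p' * n + q').
    { apply (NoDup_nth B 0); auto; try nia; apply NoDup_app_remove_l in HAB; auto. }
    apply (Nat.div_mod_unique n); auto; lia. }
  assert (Hne : forall p q p', p < n -> q < n -> p' < n -> k p q <> a p').
  { intros p q p' Hp Hq Hp' Heq; apply (HABd (a p')); auto; rewrite <- Heq; auto. }
  assert (Hmid : forall pq, exists w : list V, fst pq < n -> snd pq < n ->
     let x := att (k (fst pq) (snd pq)) (a (fst pq)) in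
     length w <= r + r /\ chain E x w /\ last w x = att (k (fst pq) (snd pq)) (a (snd pq)) /\
     NoDup (x :: w) /\ forall z, In z (x :: w) -> U (k (fst pq) (snd pq)) z).
  { intros [p q]; simpl; destruct (classic (p < n /\ q < n)) as [[Hp Hq]|Hno]; [|exists []; tauto].
    destruct (simple_path (U (k p q)) E (r + r) (att (k p q) (a p)) (att (k p q) (a q))) as [w Hw].
    - destruct (HU (k p q)) as (c & Hc & Hr); auto.
      apply reach_trans with c; [apply reach_sym; auto|]; apply Hr; apply Hatt; auto.
    - exists w; auto. }
  destruct (choice _ Hmid) as [w Hw]; clear Hmid.
  (* The legs meet the connecting branch set along edges chosen by [att]. If a leg is empty, the hub
     itself is the end of that edge. *)
  pose (P := fun p q => leg (a p) (k p q) ++ (att (k p q) (a p) :: w (p, q)) ++ rev (leg (a q) (k p q))).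
  assert (HPin : forall p q z, p < n -> q < n -> In z (P p q) ->
    (exists s, s < n /\ (s = p \/ s = q) /\ In z (leg (a s) (k p q)) /\ U (a s) z) \/ U (k p q) z).
  { intros p q z Hp Hq Hz; unfold P in Hz.
    apply in_app_or in Hz; destruct Hz as [Hz|Hz].
    - left; exists p; repeat split; auto; apply (Hfan (a p)) with (j := k p q); auto.
    - apply in_app_or in Hz; destruct Hz as [Hz|Hz].
      + right; apply (Hw (p, q)); auto.
      + apply in_rev in Hz; left; exists q; repeat split; auto.
        apply (Hfan (a q)) with (j := k p q); auto. }
  assert (HPlen : forall p q, p < n -> q < n -> length (P p q) < 4 * r + 2).
  { intros p q Hp Hq; unfold P; rewrite !length_app, length_rev; simpl.
    destruct (Hw (p, q) Hp Hq) as (Hl & _).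
    destruct (proj1 (proj2 (Hfan (a p) (Ha p Hp))) (k p q)) as (H1 & _); auto.
    destruct (proj1 (proj2 (Hfan (a q) (Ha q Hq))) (k p q)) as (H2 & _); auto.
    simpl in Hl; lia. }
  assert (HPnd : forall p q, p < n -> q < n -> p <> q -> NoDup (P p q)).
  { intros p q Hp Hq Hpq; unfold P.
    destruct (Hw (p, q) Hp Hq) as (_ & _ & _ & Hnw & HUw); simpl in Hnw, HUw.
    destruct (proj1 (proj2 (Hfan (a p) (Ha p Hp))) (k p q)) as (_ & _ & _ & N1 & U1); auto.
    destruct (proj1 (proj2 (Hfan (a q) (Ha q Hq))) (k p q)) as (_ & _ & _ & N2 & U2); auto.
    apply NoDup_app; [inversion N1; auto|apply NoDup_app; auto|].
    - apply NoDup_rev; inversion N2; auto.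
    - intros z Hz Hz'; apply in_rev in Hz'.
      apply (Hne p q q); auto; apply Hdis with z; auto; apply HUw; auto.
    - intros z Hz Hz'; apply in_app_or in Hz'; destruct Hz' as [Hz'|Hz'].
      + apply (Hne p q p); auto; apply Hdis with z; auto; apply HUw; auto.
      + apply in_rev in Hz'; apply Hpq, Hainj; auto; apply Hdis with z; auto. }
  assert (HPch : forall p q, p < n -> q < n -> chain E (hub (a p)) (P p q ++ [hub (a q)])).
  { intros p q Hp Hq; unfold P.
    destruct (Hw (p, q) Hp Hq) as (_ & Hcw & Hlw & _); simpl in Hcw, Hlw.
    destruct (proj1 (proj2 (Hfan (a p) (Ha p Hp))) (k p q)) as (_ & C1 & L1 & _); auto.
    destruct (proj1 (proj2 (Hfan (a q) (Ha q Hq))) (k p q)) as (_ & C2 & L2 & _); auto.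
    rewrite <- !app_assoc; apply chain_app; split; auto.
    rewrite L1; simpl; split; [apply Hatt; auto; apply not_eq_sym; auto|].
    apply chain_app; split; auto.
    apply chain_rev; auto; rewrite L2, Hlw; apply Hatt; auto. }
  assert (Hhubin : forall p, p < n -> U (a p) (hub (a p))) by (intros p Hp; apply Hfan; auto).
  assert (HPhub : forall p q s, p < n -> q < n -> s < n -> ~ In (hub (a s)) (P p q)).
  { intros p q s Hp Hq Hs Hin; destruct (HPin p q _ Hp Hq Hin) as [(s' & Hs' & _ & Hl & HUs)|HUk].
    - assert (s = s') by (apply Hainj; auto; eapply Hdis; eauto); subst s'.
      destruct (proj1 (proj2 (Hfan (a s) (Ha s Hs))) (k p q)) as (_ & _ & _ & N1 & _); auto.
      inversion N1; auto.
    - apply (Hne p q s); auto; eapply Hdis; eauto. }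
  assert (HPdis : forall p q p' q' z, p < n -> q < n -> p' < n -> q' < n ->
    In z (P p q) -> In z (P p' q') -> p = p' /\ q = q').
  { intros p q p' q' z Hp Hq Hp' Hq' Hz Hz'.
    destruct (HPin p q z Hp Hq Hz) as [(s & Hs & _ & Hl & HUs)|HUk];
    destruct (HPin p' q' z Hp' Hq' Hz') as [(s' & Hs' & _ & Hl' & HUs')|HUk'].
    - assert (s = s') by (apply Hainj; auto; eapply Hdis; eauto); subst s'.
      apply Hkinj; auto; apply NNPP; intros Hkk.
      apply (proj2 (proj2 (Hfan (a s) (Ha s Hs))) (k p q) (k p' q')) with z; auto.
    - exfalso; apply (Hne p' q' s); auto; eapply Hdis; eauto.
    - exfalso; apply (Hne p q s'); auto; eapply Hdis; eauto.
    - apply Hkinj; auto; eapply Hdis; eauto. }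
  destruct (Hram nat (fun p q => length (P p q)) (seq 0 n)) as (c & l & Hc & Hs & Hl & Hcol).
  { rewrite length_seq; auto. }
  { apply ForallOrdPairs_all; intros p q Hp Hq; apply in_seq in Hp, Hq; apply HPlen; lia. }
  assert (Hln : forall i, i < m -> nth i l 0 < n).
  { intros i Hi; assert (Hin : In (nth i l 0) l) by (apply nth_In; lia).
    apply (sublist_incl _ _ Hs), in_seq in Hin; lia. }
  assert (Hlinj : forall i j, i < m -> j < m -> nth i l 0 = nth j l 0 -> i = j).
  { intros i j Hi Hj; apply NoDup_nth; try lia; eapply sublist_NoDup; [exact Hs|apply seq_NoDup]. }
  exists c, (fun i => hub (a (nth i l 0))), (fun i j => P (nth i l 0) (nth j l 0)); split; [auto|].
  split; [|split].
  - intros i j Hi Hj Heq; apply Hlinj, Hainj; auto.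
    apply Hdis with (hub (a (nth i l 0))); auto; rewrite Heq; auto.
  - intros i j Hij; assert (Hi : i < m) by lia; assert (Hj : j < m) by lia.
    split; [|split; [|split]]; auto.
    + apply (ForallOrdPairs_nth _ 0 _ Hcol); lia.
    + apply HPnd; auto; intros Heq; apply Hlinj in Heq; auto; lia.
  - intros i j i' j' z Hij Hij' Hz Hz'.
    destruct (HPdis (nth i l 0) (nth j l 0) (nth i' l 0) (nth j' l 0) z) as [H1 H2];
      try (apply Hln; lia); auto.
    split; apply Hlinj; auto; lia.
Qed.

Lemma subdiv_embedding (G : graph) (E : carrier G -> carrier G -> Prop) r m m' u q :
  (forall x y, E x y -> adj G x y) -> (forall x y, E x y -> E y x) -> m' <= m ->
  is_subdivision E r m u q -> exists f, inj_hom (subdivided_clique r m') G f.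
Proof.
  intros HE Es Hm (Hu & Hq & Hd).
  pose (f := fun x : subdiv_vertex r m' => match x with
    | inl i => u (proj1_sig i)
    | inr p => nth (snd (proj1_sig p)) (q (fst (fst (proj1_sig p))) (snd (fst (proj1_sig p)))) (u 0)
    end).
  assert (Hin : forall i j k, i < j < m' -> k < r -> In (nth k (q i j) (u 0)) (q i j)).
  { intros i j k Hij Hk; apply nth_In; destruct (Hq i j) as (-> & _); [lia|auto]. }
  assert (Hbase : forall x y : subdiv_vertex r m', subdiv_base x y -> E (f x) (f y)).
  { intros [[i Hi]|[[[i j] k] [Hij Hk]]] [[i' Hi']|[[[i' j'] k'] [Hij' Hk']]]; simpl in *; intros [H1 H2].
    - destruct (Hq i i') as (Hl & _ & Hc & _); [lia|].
      subst r; destruct (q i i'); [apply Hc|discriminate].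
    - subst; destruct (Hq i j') as (Hl & _ & Hc & _); [lia|].
      destruct (q i j') as [|z w]; simpl in *; [lia|apply Hc].
    - subst; destruct (Hq i i') as (Hl & _ & Hc & _); [lia|].
      assert (Hl' : length (q i i' ++ [u i']) = S (S k)) by (rewrite length_app; simpl; lia).
      pose proof (chain_nth E (u 0) _ _ k Hc ltac:(lia)) as H.
      rewrite app_nth1 in H by lia; rewrite app_nth2 in H by lia.
      rewrite <- Hl, Nat.sub_diag in H; exact H.
    - injection H1 as <- <-; subst; destruct (Hq i j) as (Hl & _ & Hc & _); [lia|].
      apply chain_app in Hc; apply (chain_nth E (u 0) _ _ k (proj1 Hc)); lia. }
  exists f; split.
  - intros [[i Hi]|[[[i j] k] [Hij Hk]]] [[i' Hi']|[[[i' j'] k'] [Hij' Hk']]] Heq; simpl in *.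
    + f_equal; apply lt_sig_eq; simpl; apply Hu; auto; lia.
    + exfalso; destruct (Hq i' j') as (_ & _ & _ & Hn); [lia|].
      apply (Hn i); [lia|]; rewrite Heq; auto.
    + exfalso; destruct (Hq i j) as (_ & _ & _ & Hn); [lia|].
      apply (Hn i'); [lia|]; rewrite <- Heq; auto.
    + assert (H : i = i' /\ j = j').
      { apply (Hd i j i' j' (nth k (q i j) (u 0))); auto; try lia; rewrite Heq; auto. }
      destruct H as [-> ->].
      assert (k = k') as ->.
      { destruct (Hq i' j') as (Hl & Hn & _); [lia|].
        apply (NoDup_nth (q i' j') (u 0)); auto; lia. }
      do 2 f_equal; apply proof_irrelevance.
  - intros [] l (x & y & -> & Hxy); simpl.
    apply HE; destruct Hxy as [H|H]; [|apply Es]; apply Hbase; auto.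
Qed.

Lemma rminor_shallow_clique {Sg} (M : structure Sg) r t :
  rminor r (complete t) (gaifman M) -> shallow_clique (gadj M) r t.
Proof.
  intros (uv & ue & pi & Hue & Hc & Hadj).
  exists (fun i x => uv x /\ proj1_sig (pi x) = i); split.
  - intros i Hi; destruct (Hc (exist _ i Hi)) as (c & Huc & Hpc & Hr).
    exists c; split; [rewrite Hpc; auto|].
    intros y [Hy Hpy]; apply reach_edges with (E := ue).
    { intros x z _ _ Hxz; apply adj_gaifman, Hue; auto. }
    apply reach_mono with (3 := Hr y Hy ltac:(apply lt_sig_eq; auto)); auto.
    intros z [Hz Hpz]; rewrite Hpz; auto.
  - intros i j Hi Hj Hij; split; [intros x [_ H1] [_ H2]; congruence|].
    destruct (proj1 (Hadj (exist _ i Hi) (exist _ j Hj))) as (_ & x & y & Hxy & Hx & Hy).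
    { apply adj_complete; intros H; injection H; auto. }
    destruct (Hue x y Hxy) as (Ha & Hux & Huy & _).
    exists x, y; rewrite Hx, Hy; repeat split; auto; apply adj_gaifman in Ha; apply Ha.
Qed.

Lemma superflat_nowhere_dense {Sg} (C : structure Sg -> Prop) :
  superflat (underline C) -> nowhere_dense (underline C).
Proof.
  intros Hsf r.
  (* The length [c] comes out of the construction only after [m] is fixed, so one [m] must reach the
     bounds of all lengths below [4 * r + 2]. *)
  assert (Hm : forall k, exists m, forall c, c < k -> exists m', m' <= m /\
    forall M, C M -> ~ exists f, inj_hom (subdivided_clique c m') (gaifman M) f).
  { induction k as [|k [m IH]]; [exists 0; intros; lia|].
    destruct (Hsf k) as [mk Hk]; exists (m + mk); intros c Hck.
    destruct (Nat.eq_dec c k) as [->|Hne].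
    - exists mk; split; [lia|]; intros M HM; apply Hk; exists M; auto.
    - destruct (IH c ltac:(lia)) as (m' & Hm' & H); exists m'; split; [lia|auto]. }
  destruct (Hm (4 * r + 2)) as [m Hmm].
  destruct (shallow_clique_subdivision r m) as [t Ht]; exists t.
  intros G n (M & HM & ->) Hmin; apply NNPP; intros Hn.
  apply rminor_shallow_clique in Hmin.
  destruct (Ht (carrier M) (gadj M) (gadj_sym M)) as (c & u & q & Hc & Hsub).
  { destruct Hmin as (U & H1 & H2); exists U; split; intros; [apply H1|apply H2]; auto; lia. }
  destruct (Hmm c Hc) as (m' & Hm' & Hno); apply (Hno M HM).
  exact (subdiv_embedding (gaifman M) (gadj M) c m m' u q
    (fun x y H => proj2 (adj_gaifman M x y) H) (gadj_sym M) Hm' Hsub).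
Qed.

Theorem theorem5p2 (S : signature) (C : structure S -> Prop) (HC : monotone C) :
  (nowhere_dense (underline C) <-> superflat (underline C)) /\
  (nowhere_dense (underline C) <-> stable C) /\
  (nowhere_dense (underline C) <-> stable (underline C)) /\
  (nowhere_dense (underline C) <-> dependent C) /\
  (nowhere_dense (underline C) <-> dependent (underline C)).
Proof.
  assert (H13 : nowhere_dense (underline C) -> stable C).
  { intros H; destruct (nowhere_dense_sparse C H) as [bound Hb]; eapply sparse_stable; eauto. }
  assert (H21 := superflat_nowhere_dense C).
  assert (H62 := dependent_superflat C HC).
  assert (H34 := stable_underline C); assert (H56 := dependent_underline C).
  assert (H35 := stable_dependent C); assert (H46 := stable_dependent (underline C)).
  tauto.
Qed.
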